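(* For every constant $c>1$ there exists a constant $\delta=\delta(c)>0$ such that asymptotically almost surely $$\delta\sqrt{n}\;\le\;\mathrm{ccl}(G_{n,c/n})\;\le\;2\sqrt{cn}.$$
   Context: $G_{n,p}$ denotes the binomial random graph on $n$ vertices in which each pair of vertices is an edge independently with probability $p$; here $p=c/n$. A graph $H$ is a minor of $G$ if for every vertex $h$ of $H$ there is a set $B_h\subseteq V(G)$ inducing a connected subgraph of $G$, the sets $B_h$ are pairwise disjoint, and $G$ has an edge between $B_h$ and $B_{h'}$ whenever $hh'$ is an edge of $H$. $\mathrm{ccl}(G)$ denotes the largest $k$ such that the complete graph $K_k$ is a minor of $G$. An event holds asymptotically almost surely (a.a.s.) if its probability tends to $1$ as $n\to\infty$. *)

(* Defs.v *)
From HB Require Import structures.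
From mathcomp Require Import all_boot.
From Stdlib Require Import Reals ClassicalEpsilon.

Set Implicit Arguments.
Unset Strict Implicit.
Unset Printing Implicit Defensive.

Definition pairs (n : nat) : {set {set 'I_n}} := [set e : {set 'I_n} | #|e| == 2].

Definition is_graph (n : nat) (E : {set {set 'I_n}}) : bool := E \subset pairs n.

Definition adj (n : nat) (E : {set {set 'I_n}}) (u v : 'I_n) : bool :=
  (u != v) && ([set u; v] \in E).

Definition connected_in (n : nat) (E : {set {set 'I_n}}) (S : {set 'I_n}) : bool :=
  (S != set0) &&
  [forall u in S, forall v in S,
     connect (fun x y => [&& x \in S, y \in S & adj E x y]) u v].

Definition has_K_minor (n : nat) (E : {set {set 'I_n}}) (k : nat) : bool :=
  [exists B : {ffun 'I_k -> {set 'I_n}},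
     [forall h, connected_in E (B h)] &&
     [forall h, forall h', (h != h') ==>
        [disjoint B h & B h'] &&
        [exists u in B h, exists v in B h', adj E u v]]].

(* ccl(G): the largest k such that K_k is a minor of G.
   (Any such k is at most n, since the branch sets are nonempty and disjoint.) *)
Definition ccl (n : nat) (E : {set {set 'I_n}}) : nat :=
  \max_(k < n.+1 | has_K_minor E k) k.

Definition Gnp_weight (n : nat) (p : R) (E : {set {set 'I_n}}) : R :=
  if is_graph E then (p ^ #|E| * (1 - p) ^ (#|pairs n| - #|E|))%R else 0%R.

Definition Pr_Gnp (n : nat) (p : R) (A : {set {set 'I_n}} -> Prop) : R :=
  \big[Rplus/0%R]_(E : {set {set 'I_n}})
     (if excluded_middle_informative (A E) then Gnp_weight p E else 0%R).

Definition aas (p : nat -> R) (A : forall n : nat, {set {set 'I_n}} -> Prop) : Prop :=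
  Un_cv (fun n => Pr_Gnp (p n) (A n)) 1%R.

(* Main.v *)
(* Upper bound: a K_k minor uses k(k-1)/2 edges, and a.a.s. there are at most
   cn of them.

   Lower bound: write G(n,c/n) as the union of independent G(n,p1) and
   G(n,eps/n) with p1 n > 1. A.a.s. G(n,p1) has a path on gamma n vertices,
   because depth-first search on a supercritical graph keeps a long stack. Cut
   this path into k = 4^q hubs of length of order sqrt n, and into connectors.
   Two hubs are joined by an edge of G(n,eps/n) only with constant probability,
   so they are linked through connectors instead, in q rounds. Round r uses
   fresh connectors of length s 4^r, of which there are about n 8^-r. With
   b_r = k^2 16^-r pairs of hubs still unlinked on entering it, one first drops
   the hubs lying in too many of these pairs, in total less than half of all
   hubs. A connector then links some pair out of any b_(r+1) remaining ones with
   probability bounded below, so a union bound over all sets of pairs and all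
   sets of used connectors shows that a maximal matching of pairs to connectors
   leaves fewer than b_(r+1) pairs. After q rounds no pair is left. *)
Require Import Defs.
From HB Require Import structures.
From mathcomp Require Import all_boot all_order all_algebra.
From mathcomp Require Import zify ring lra.
From mathcomp Require Import Rstruct.
From Stdlib Require Reals.

Set Implicit Arguments.
Unset Strict Implicit.
Unset Printing Implicit Defensive.
Import Order.TTheory GRing.Theory Num.Theory.
Local Open Scope ring_scope.

(** * Expectation over a binomial random subset *)

(** The scales balance two demands. With [4^q] hubs of length of order [4^q] and [n] of order
    [16^q], a connector of length [s 4^r] reaches a given hub with probability of order [4^(r-q)].
    So among [b_(r+1) = 16^(q-r-1)] pairs, the expected number linked by one connector is of
    constant order. Turning this mean into a probability takes a second moment, and pairs sharing a
    hub are correlated: this is why hubs of large degree are dropped. The union bound costs a factor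
    exponential in [r] for each of the [b_r] units, so the number of connectors must exceed [b_r] by
    a factor growing with [r]. The factor [s 2^r] does so, while the total length [s^2 8^r 16^(q-r)]
    of the connectors of a round still decays geometrically. Round [r] then fails with probability
    at most [exp (- 2^r 16^(q-r))], small even in the last round. Expectations are finite sums;
    resampling one element at a time yields the product formulas, the coupling of two random graphs
    and the martingale of the search. *)

Section RandomSubset.
Variables (R : realFieldType) (T : finType) (U : {set T}).
Implicit Types (p : R) (e : T) (E D : {set T}) (F G : {set T} -> R) (s : seq T).

Definition wt p E : R :=
  if E \subset U then p ^+ #|E| * (1 - p) ^+ (#|U| - #|E|) else 0.

Definition expect p F : R := \sum_E wt p E * F E.

Definition det_by D F := forall E E', E :&: D = E' :&: D -> F E = F E'.

(* The conditional expectation of F given the status of all elements but e. *)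
Definition avg p F e E : R := p * F (e |: E) + (1 - p) * F (E :\ e).

Definition avgs p s F := foldr (fun e F => avg p F e) F s.

Lemma sum_split_elt e F :
  \sum_E F E = \sum_(E : {set T} | e \notin E) (F (e |: E) + F E).
Proof.
rewrite (bigID (fun E : {set T} => e \in E)) /= big_split /=; congr (_ + _).
rewrite (reindex_onto (fun E : {set T} => e |: E) (fun E => E :\ e)) /=.
  apply: eq_bigl => E; rewrite setU11 /=; apply/eqP/idP => [<-|eE].
    by rewrite setD11.
  by rewrite setU1K.
by move=> E eE; rewrite setD1K.
Qed.

(** Cross-multiplied form of the odds [p : 1 - p] of containing [e]; it stays meaningful at
    [p = 1]. *)
Lemma wtU1 p e E : e \in U -> e \notin E ->
  (1 - p) * wt p (e |: E) = p * wt p E.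
Proof.
move=> eU eE; rewrite /wt subUset sub1set eU /=.
case: ifP => EU; last by rewrite !mulr0.
have lt : (#|E| < #|U|)%N.
  apply: proper_card; apply/properP; split=> //.
  by exists e.
rewrite cardsU1 eE /= -(subnSK lt) add1n !exprS; ring.
Qed.

(** Resampling [e] does not change the law, since the weights of [E] and [e |: E] are in the ratio
    [1 - p : p]. The independence statements below go back to this one. *)
Lemma expect_avg p F e : e \in U -> expect p F = expect p (avg p F e).
Proof.
move=> eU; rewrite /expect (sum_split_elt e) [in RHS](sum_split_elt e).
apply: eq_bigr => E eE; rewrite /avg setUA setUid setU1K //.
have -> : E :\ e = E by apply/setDidPl; rewrite disjoint_sym disjoints1.
have := wtU1 p eU eE.
set a := wt _ _; set b := wt _ _; set x := F _; set y := F _ => H.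
have -> : a * (p * x + (1 - p) * y) = a * p * x + (1 - p) * a * y by ring.
rewrite H.
have -> : a * p = a - p * b by rewrite -H; ring.
ring.
Qed.

Lemma expect_avgs p s F : {subset s <= U} ->
  expect p (avgs p s F) = expect p F.
Proof.
elim: s F => //= e s IH F sU; rewrite -expect_avg ?sU ?mem_head //.
by apply: IH => x xs; apply: sU; rewrite inE xs orbT.
Qed.

Lemma expect_cst p (a : R) : expect p (fun=> a) = a.
Proof.
rewrite /expect -big_distrl /=.
suff -> : \sum_E wt p E = 1 by rewrite mul1r.
(* Expanding the product of the factors [p + (1 - p)] over [U] and [0 + 1] outside gives one term
   per set, and the zero kills the sets not contained in [U]. *)
have := @bigA_distr R 0 1 *%R +%R T
  (fun i => if i \in U then p else 0) (fun i => if i \in U then 1 - p else 1).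
rewrite big1 => [|i _]; last by case: (i \in U) => /=; ring.
move=> ->; apply: eq_bigr => E _.
rewrite /wt; case: ifPn => [EU|/subsetPn [x xE xU]]; last first.
  by rewrite (bigD1 x) //= xE (negPf xU) mul0r.
rewrite (bigID (fun i => i \in E)) /=; congr (_ * _).
  rewrite -prodr_const; apply: eq_bigr => i iE.
  by rewrite iE (subsetP EU).
rewrite -(cardsDS EU) -prodr_const [RHS](bigID (fun i => i \in U)) /=.
rewrite [X in _ * X]big1 ?mulr1; last by move=> i /andP [/negPf -> /negPf ->].
apply: eq_big => i; first by rewrite !inE.
by rewrite inE => /andP [/negPf -> ->].
Qed.

Lemma eq_expect p F G : (forall E, E \subset U -> F E = G E) ->
  expect p F = expect p G.
Proof.
move=> FG; apply: eq_bigr => E _; rewrite /wt.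
by case: ifP => [/FG ->|] //; rewrite !mul0r.
Qed.

Lemma expectD p F G :
  expect p (fun E => F E + G E) = expect p F + expect p G.
Proof. by rewrite -big_split; apply: eq_bigr => E _; rewrite mulrDr. Qed.

Lemma expectZ p (a : R) F : expect p (fun E => a * F E) = a * expect p F.
Proof. by rewrite /expect big_distrr; apply: eq_bigr => E _ /=; ring. Qed.

Lemma expectN p F : expect p (fun E => - F E) = - expect p F.
Proof. by rewrite /expect -sumrN; apply: eq_bigr => E _; rewrite mulrN. Qed.

Lemma expectB p F G :
  expect p (fun E => F E - G E) = expect p F - expect p G.
Proof. by rewrite expectD expectN. Qed.

Lemma expect_sum p (I : finType) (P : pred I) (F : I -> {set T} -> R) :
  expect p (fun E => \sum_(i | P i) F i E) = \sum_(i | P i) expect p (F i).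
Proof.
rewrite /expect exchange_big /=.
by apply: eq_bigr => E _; rewrite big_distrr.
Qed.

Lemma wt_ge0 p E : 0 <= p <= 1 -> 0 <= wt p E.
Proof.
case/andP=> p0 p1; rewrite /wt; case: ifP => // _.
by rewrite mulr_ge0 ?exprn_ge0 ?subr_ge0.
Qed.

Lemma ler_expect p F G : 0 <= p <= 1 ->
  (forall E, E \subset U -> F E <= G E) -> expect p F <= expect p G.
Proof.
move=> p01 FG; apply: ler_sum => E _; rewrite /wt.
case: ifP => [EU|]; last by rewrite !mul0r.
have := wt_ge0 E p01; rewrite /wt EU => w0.
by apply: ler_wpM2l (FG _ EU).
Qed.

Lemma expect_ge0 p F : 0 <= p <= 1 ->
  (forall E, E \subset U -> 0 <= F E) -> 0 <= expect p F.
Proof. by move=> p01 F0; rewrite -(expect_cst p 0); apply: ler_expect. Qed.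

Lemma avgs_mulr p s D F G : {subset s <= D} -> det_by (~: D) G ->
  forall E, avgs p s (fun E => F E * G E) E = avgs p s F E * G E.
Proof.
move=> sD detG; elim: s sD => //= e s IH sD E.
have eD := sD e (mem_head _ _).
have {}IH := IH (fun x xs => sD x (mem_behead (s := e :: s) xs)).
rewrite /avg !IH.
have -> : G (e |: E) = G E.
  apply: detG; apply/setP=> x; rewrite !inE.
  by case: eqP => // ->; rewrite eD !andbF.
have -> : G (E :\ e) = G E.
  apply: detG; apply/setP=> x; rewrite !inE.
  by case: eqP => // ->; rewrite eD !andbF.
ring.
Qed.

Lemma det_by_avgs p s D F : det_by D F ->
  det_by (D :\: [set x in s]) (avgs p s F).
Proof.
elim: s D F => [|e s IH] D F detF E E' EE' /=.
  apply: detF; suff D0 : D :\: [set x in [::]] = D by rewrite D0 in EE'.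
  by apply/setP=> x; rewrite !inE.
have H := IH _ _ detF.
congr (_ * _ + _ * _); apply: H; apply/setP=> x; move/setP/(_ x): EE';
  rewrite !inE; case: eqVneq => [->|] //=.
Qed.

(** Averaging over [A :&: U] turns [F] into a constant on subsets of [U] and leaves [G] alone. The
    same computation with [G = 1] identifies the constant. *)
Lemma expect_mul p A B F G : det_by A F -> det_by B G -> [disjoint A & B] ->
  expect p (fun E => F E * G E) = expect p F * expect p G.
Proof.
move=> detF detG AB.
pose s := enum (A :&: U).
have sU : {subset s <= U} by move=> x; rewrite mem_enum inE => /andP [].
have sA : {subset s <= A} by move=> x; rewrite mem_enum inE => /andP [].
have detG' : det_by (~: A) G.
  move=> E E' EE'; apply: detG; apply/setP=> x.
  move/setP/(_ x): EE'; rewrite !inE.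
  case xB: (x \in B); rewrite ?andbF // !andbT.
  by rewrite (disjointFl AB xB) !andbT.
have avgsC E : E \subset U -> avgs p s F E = avgs p s F set0.
  move=> EU; apply: (@det_by_avgs p _ _ _ detF); apply/setP=> x; rewrite !inE.
  rewrite mem_enum inE; case xE: (x \in E) => //=.
  by rewrite (subsetP EU) // andbT andNb.
have key H : det_by (~: A) H ->
    expect p (fun E => F E * H E) = avgs p s F set0 * expect p H.
  move=> detH; rewrite -(expect_avgs p _ sU) -expectZ.
  apply: eq_expect => E EU.
  by rewrite (avgs_mulr p F sA detH) avgsC.
rewrite key //; congr (_ * _).
have := key (fun=> 1) (fun _ _ _ => erefl); rewrite expect_cst mulr1 => <-.
by apply: eq_expect => E _; rewrite mulr1.
Qed.

Lemma expect_prod p (I : finType) (P : pred I) (D : I -> {set T})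
    (F : I -> {set T} -> R) :
  (forall i, P i -> det_by (D i) (F i)) ->
  (forall i j, P i -> P j -> i != j -> [disjoint D i & D j]) ->
  expect p (fun E => \prod_(i | P i) F i E) = \prod_(i | P i) expect p (F i).
Proof.
move=> detF disD; rewrite -big_filter.
under eq_expect do rewrite -big_filter.
have : uniq [seq i <- index_enum I | P i].
  by rewrite filter_uniq ?index_enum_uniq.
have : {in [seq i <- index_enum I | P i], forall i, P i}.
  by move=> i; rewrite mem_filter => /andP [].
elim: [seq i <- _ | _] => [|i r IH] Pr /=.
  move=> _; rewrite big_nil -[RHS](expect_cst p).
  by apply: eq_expect => E _; rewrite big_nil.
case/andP=> ir ur.
have Pi := Pr _ (mem_head _ _).
have Pr' : {in r, forall i, P i} by move=> j jr; apply: Pr; rewrite inE jr orbT.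
rewrite big_cons -IH //.
under eq_expect do rewrite big_cons.
apply: (@expect_mul p (D i) (\bigcup_(j in r) D j)).
- exact: detF.
- move=> E E' EE'; apply: eq_big_seq => j jr; apply: detF; first exact: Pr'.
  have sub : D j \subset \bigcup_(j in r) D j by apply: (bigcup_sup j).
  by rewrite -(setIidPr sub) !setIA EE'.
- apply: bigcup_disjoint => j jr; apply: disD => //; first exact: Pr'.
  by apply/eqP => ij; rewrite ij jr in ir.
Qed.

Lemma expect_disjoint p D : D \subset U ->
  expect p (fun E => [disjoint D & E]%:R) = (1 - p) ^+ #|D|.
Proof.
move=> DU.
have -> : expect p (fun E => [disjoint D & E]%:R) =
          expect p (fun E => \prod_(e in D) (e \notin E)%:R).
  apply: eq_expect => E _; case: (boolP [disjoint _ & _]) => DE.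
    by rewrite big1 // => e eD; rewrite (disjointFr DE eD).
  case/pred0Pn: DE => x /= /andP [xD xE].
  by rewrite (bigD1 x) //= xE mul0r.
rewrite (@expect_prod p _ _ (fun e => [set e])).
- rewrite -prodr_const; apply: eq_bigr => e eD.
  rewrite (expect_avg _ _ (subsetP DU e eD)) -[RHS](expect_cst p).
  by apply: eq_expect => E _; rewrite /avg !inE eqxx /= mulr0 add0r mulr1.
- move=> e _ E E' /setP/(_ e); rewrite !inE eqxx !andbT.
  by move=> ->.
- by move=> i j _ _ ij; rewrite disjoints1 inE.
Qed.

(** An element is missing from [E1 :|: E2] when both sets miss it. Averaging element by element
    leaves both sides unchanged and ends in a function constant on subsets of [U]. *)
Lemma expect_coupling p p1 p2 F : 1 - p = (1 - p1) * (1 - p2) ->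
  expect p F = expect p1 (fun E1 => expect p2 (fun E2 => F (E1 :|: E2))).
Proof.
move=> pE.
have pE' : p = p1 + (1 - p1) * p2.
  by rewrite -[p](opprK) -[- p](addrK 1) [- p + 1]addrC pE; ring.
pose H G := expect p1 (fun E1 => expect p2 (fun E2 => G (E1 :|: E2))).
(* With [e] in [E1] its status in [E2] is immaterial; otherwise it is resampled in [E2] as well. *)
have step e G : e \in U -> H (avg p G e) = H G.
  move=> eU; rewrite /H [in RHS](expect_avg _ _ eU); apply: eq_expect => E1 _.
  rewrite /avg [X in _ = X + _](_ : _ = p1 * expect p2 (fun E2 => G (e |: (E1 :|: E2)))); last first.
    by congr (_ * _); apply: eq_expect => E2 _; rewrite setUA.
  rewrite [X in _ = _ + _ * X](expect_avg _ _ eU) -!expectZ -expectD.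
  apply: eq_expect => E2 _.
  rewrite /avg -setDUl.
  have -> : (E1 :\ e) :|: (e |: E2) = e |: (E1 :|: E2).
    by apply/setP=> x; rewrite !inE; case: eqP.
  by rewrite pE pE'; ring.
have steps s : {subset s <= U} -> H (avgs p s F) = H F.
  elim: s => //= e s IH sU; rewrite step ?sU ?mem_head //.
  by apply: IH => x xs; apply: sU; rewrite inE xs orbT.
have sU : {subset enum U <= U} by move=> x; rewrite mem_enum.
have detF : det_by setT F by move=> E E'; rewrite !setIT => ->.
have avgsC E : E \subset U -> avgs p (enum U) F E = avgs p (enum U) F set0.
  move=> EU; apply: (@det_by_avgs p _ _ _ detF); apply/setP=> x; rewrite !inE.
  rewrite mem_enum; case xE: (x \in E) => //=.
  by rewrite (subsetP EU).
have -> : expect p F = avgs p (enum U) F set0.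
  by rewrite -(expect_avgs p F sU) -[RHS](expect_cst p); apply: eq_expect.
rewrite -/(H F) -(steps _ sU) -[LHS](expect_cst p1); apply: eq_expect => E1 E1U.
rewrite -[LHS](expect_cst p2); apply: eq_expect => E2 E2U.
by rewrite avgsC // subUset E1U.
Qed.

End RandomSubset.

(** * Long paths by depth-first search *)

Definition has_path n (E : {set {set 'I_n}}) (y : nat) : bool :=
  [exists s : y.-tuple 'I_n, uniq s && sorted (adj E) s].

Lemma adjC n (E : {set {set 'I_n}}) u v : adj E u v = adj E v u.
Proof. by rewrite /adj eq_sym setUC. Qed.

(** A stack entry carries a vertex of the current path with the candidates it has yet to query. Of
    the finished vertices and of the answers only the numbers are kept, which is all that the weight
    and the final count use. *)
Record dfs_state n := DfsState {
  done_count : nat;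
  stack : seq ('I_n * seq 'I_n);
  unseen : {set 'I_n};
  yes_count : nat;
  no_count : nat }.

Section DepthFirstSearch.
Variables (n x y : nat).
Implicit Types (E : {set {set 'I_n}}) (st : dfs_state n).

Definition halted st := (x <= done_count st)%N || (y <= size (stack st))%N.

(** A halted state is a fixed point, so iterating often enough amounts to running until the search
    stops. A candidate already seen is skipped without looking at [E]. *)
Definition dfs_step E st : dfs_state n :=
  let: DfsState d k t a b := st in
  if halted st then st else
  match k with
  | [::] => if [pick v in t] is Some v
            then DfsState d [:: (v, enum (t :\ v))] (t :\ v) a b else st
  | (u, [::]) :: k' => DfsState d.+1 k' t a b
  | (u, w :: l) :: k' =>
      if w \notin t then DfsState d ((u, l) :: k') t a b
      else if adj E u w
      then DfsState d ((w, enum (t :\ w)) :: (u, l) :: k') (t :\ w) a.+1 b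
      else DfsState d ((u, l) :: k') t a b.+1
  end.

Definition dfs_run E fuel st := iter fuel (dfs_step E) st.

Definition dfs_init : dfs_state n := DfsState 0 [::] setT 0 0.

(* A superset of the edges that a run from st can still query. *)
Definition unexposed st : {set {set 'I_n}} :=
  [set e | [exists t in unseen st, exists t' in unseen st, e == [set t; t']]
    || has (fun ul => has (fun w => (w \in unseen st) && (e == [set ul.1; w])) ul.2)
           (stack st)].

Lemma unexposedP st e : reflect
  ((exists t t', [/\ t \in unseen st, t' \in unseen st & e = [set t; t']]) \/
   (exists u l w, [/\ (u, l) \in stack st, w \in l, w \in unseen st & e = [set u; w]]))
  (e \in unexposed st).
Proof.
rewrite inE; apply: (iffP orP) => [[]|[]].
- by case/exists_inP=> t tT /exists_inP [t' tT' /eqP ->]; left; exists t, t'.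
- case/hasP=> -[u l] ul /hasP [w wl /andP [wT /eqP ->]].
  by right; exists u, l, w.
- case=> t [t'] [tT tT' ->]; left; apply/exists_inP; exists t => //.
  by apply/exists_inP; exists t'.
- case=> u [l] [w] [ul wl wT ->]; right; apply/hasP; exists (u, l) => //.
  by apply/hasP; exists w => //; rewrite wT eqxx.
Qed.

Definition valid st := [/\ uniq (map fst (stack st)),
  forall u, u \in map fst (stack st) -> u \notin unseen st,
  all (fun ul => uniq ul.2) (stack st) &
  (done_count st + size (stack st) + #|unseen st| = n)%N].

(** A positive answer pushes a vertex, whence the third clause. In the fourth, a finished vertex
    accounts for one negative answer per unseen vertex, and a stack vertex for one per unseen vertex
    no longer on its list. *)
Definition dfs_inv E st :=
  [/\ sorted (adj E) (map fst (stack st)),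
      (done_count st <= x)%N,
      (yes_count st <= done_count st + size (stack st))%N &
      (done_count st * #|unseen st| +
       \sum_(ul <- stack st) #|unseen st :\: [set z in ul.2]| <= no_count st)%N].

Lemma step_valid E st : valid st -> valid (dfs_step E st).
Proof.
case: st => d k t a b [/= uk kt lk sz]; rewrite /dfs_step.
case: ifP => // _; case: k uk kt lk sz => [|[u [|w l]] k] uk kt lk sz.
- case: pickP => //= v vt; split=> //=.
  + by move=> z; rewrite inE => /eqP ->; rewrite !inE eqxx.
  + by rewrite enum_uniq.
  + by move: sz; rewrite (cardsD1 v t) vt /=; move: #|_| => c; lia.
- split=> //=; last by move: sz => /=; lia.
  + by case/andP: uk.
  + by move=> z zk; apply: kt; rewrite inE zk orbT.
- move: lk => /= /andP [/andP [_ ul] lk].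
  case: ifPn => [wt|/negPn wt]; first by split=> //=; rewrite ul lk.
  case: ifP => _; last by split=> //=; rewrite ul lk.
  split=> /=.
  + move: uk => /= ->; rewrite andbT; apply/negP => /kt.
    by rewrite wt.
  + move=> z; rewrite inE => /orP [/eqP ->|]; first by rewrite !inE eqxx.
    by move=> /kt zt; rewrite inE (negPf zt) andbF.
  + by rewrite enum_uniq ul lk.
  + by move: sz; rewrite (cardsD1 w t) wt /=; move: #|_| => c; lia.
Qed.

Lemma step_inv E st : valid st -> dfs_inv E st -> dfs_inv E (dfs_step E st).
Proof.
case: st => d k t a b [/= uk kt lk sz] [/= pk dx ya nb]; rewrite /dfs_step.
case: ifPn => // /norP [/=]; rewrite -!ltnNge => dx' ky.
case: k uk kt lk sz pk ya nb ky => [|[u [|w l]] k] uk kt lk sz pk ya nb ky.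
- case: pickP => //= v vt; split=> //=; first by move: ya => /=; lia.
  rewrite big_seq1 /= (_ : (t :\ v) :\: _ = set0) ?cards0 ?addn0; last first.
    by apply/setP=> z; rewrite !inE mem_enum !inE andNb.
  apply: leq_trans nb; rewrite big_nil addn0 leq_mul2l subset_leq_card ?orbT //.
  exact: subsetDl.
- split=> //=; first by exact: path_sorted pk.
  + by move: ya => /=; lia.
  + move: nb; rewrite big_cons /= (_ : _ :\: _ = t) ?mulSn; first lia.
    by apply/setP=> z; rewrite !inE.
- case: ifPn => [wt|/negPn wt].
    split=> //=; move: nb; rewrite !big_cons /=.
    rewrite (_ : t :\: [set z in w :: l] = t :\: [set z in l]) //.
    apply/setP=> z; rewrite !inE; case: eqP => //= ->.
    by rewrite (negPf wt) andbF.
  case: ifP => uw; last first.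
    split=> //=; move: nb; rewrite !big_cons /=.
    (* Removing [w] from the list raises the count of [u] by at most one, paid for by the new
       negative answer. *)
    rewrite (cardsD1 w (t :\: [set z in l])) !inE wt andbT.
    rewrite (_ : t :\: [set z in w :: l] = (t :\: [set z in l]) :\ w); last first.
      by apply/setP=> z; rewrite !inE negb_or andbA.
    move: #|_ :\ w| (d * #|t|)%N (\sum_(_ <- _) _)%N => c1 c2 c3.
    by case: (w \notin l); lia.
  have sub : t :\ w \subset t by apply: subsetDl.
  split=> //=.
  + by rewrite adjC uw.
  + by move: ya => /=; lia.
  + rewrite !big_cons /= in nb *; apply: leq_trans nb.
    rewrite (_ : (t :\ w) :\: [set z in enum (t :\ w)] = set0); last first.
      by apply/setP=> z; rewrite !inE mem_enum !inE andNb.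
    rewrite cards0 add0n leq_add //.
      by rewrite leq_mul2l subset_leq_card ?orbT.
    apply: leq_add.
      apply: subset_leq_card; apply/subsetP => z; rewrite !inE negb_or.
      by case/and3P=> -> -> ->.
    by apply: leq_sum => i _; apply: subset_leq_card; apply: setSD.
Qed.

(** An unseen vertex weighs [n.+2] because pushing it adds a list of fewer than [n] candidates and
    one unit for the entry itself. *)
Definition dfs_measure st : nat :=
  (#|unseen st| * n.+2 + \sum_(ul <- stack st) (size ul.2).+1)%N.

Lemma dfs_measure_step E st : (x <= n)%N -> valid st -> ~~ halted st ->
  (dfs_measure (dfs_step E st) < dfs_measure st)%N.
Proof.
case: st => d k t a b xn [/= uk kt lk sz] nh; rewrite /dfs_step (negPf nh).
have tn v : v \in t -> (#|t :\ v| < n)%N.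
  by move=> vt; move: sz; rewrite (cardsD1 v t) vt; move: #|_ :\ _| => c; lia.
case: k uk kt lk sz nh => [|[u [|w l]] k] uk kt lk sz nh.
- case: pickP => [v vt|t0].
    rewrite /dfs_measure /= big_seq1 big_nil /= -cardE (cardsD1 v t) vt.
    by have := tn v vt; move: #|_ :\ _| => c; lia.
  (* With an empty stack and nothing unseen, all [n] vertices are finished, and [x <= n] makes this
     a halting state. *)
  have t_0 : t = set0 by apply/setP=> z; rewrite t0 inE.
  move: nh sz; rewrite t_0 cards0 /halted /=.
  by case: leqP => //=; lia.
- by rewrite /dfs_measure /= big_cons /=; lia.
- case: ifPn => [wt|/negPn wt]; first by rewrite /dfs_measure /= !big_cons /=; lia.
  case: ifP => _; last by rewrite /dfs_measure /= !big_cons /=; lia.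
  rewrite /dfs_measure /= !big_cons /= -cardE (cardsD1 w t) wt.
  by have := tn w wt; move: #|_ :\ _| (\sum_(_ <- _) _)%N => c c'; lia.
Qed.

Lemma dfs_runS E fuel st : dfs_run E fuel.+1 st = dfs_run E fuel (dfs_step E st).
Proof. exact: iterSr. Qed.

Lemma dfs_step_halted E st : halted st -> dfs_step E st = st.
Proof. by case: st => d k t a b h; rewrite /dfs_step h. Qed.

Lemma dfs_run_halted E fuel st : (x <= n)%N -> valid st ->
  (dfs_measure st <= fuel)%N -> halted (dfs_run E fuel st).
Proof.
move=> xn; elim: fuel st => [|fuel IH] st vst mst.
  apply: contraLR mst => nh; rewrite -ltnNge.
  exact: leq_trans (dfs_measure_step E xn vst nh).
rewrite dfs_runS; case: (boolP (halted st)) => h.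
  rewrite dfs_step_halted //; elim: fuel {IH mst} => [|f IH] //.
  by rewrite dfs_runS dfs_step_halted.
apply: IH; first exact: step_valid.
by rewrite -ltnS; apply: leq_trans mst; apply: dfs_measure_step.
Qed.

Lemma dfs_run_inv E fuel st : valid st -> dfs_inv E st ->
  valid (dfs_run E fuel st) /\ dfs_inv E (dfs_run E fuel st).
Proof.
elim: fuel st => [|f IH] st v i //.
by rewrite dfs_runS; apply: IH; [apply: step_valid | apply: step_inv].
Qed.

(** A pushed vertex was unseen, so its queries to unseen vertices were already counted as pairs of
    unseen vertices. *)
Lemma unexposed_step E st : unexposed (dfs_step E st) \subset unexposed st.
Proof.
case: st => d k t a b; rewrite /dfs_step; case: ifP => // _.
case: k => [|[u [|w l]] k].
- case: pickP => //= v vt; apply/subsetP => e /unexposedP /= H; apply/unexposedP => /=.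
  case: H => [[t1 [t2 [/setD1P [_ t1t] /setD1P [_ t2t] ->]]]|]; first by left; exists t1, t2.
  case=> u [l] [w] []; rewrite inE => /eqP [-> ->]; rewrite mem_enum.
  by case/setD1P=> _ wt _ ->; left; exists v, w.
- apply/subsetP => e /unexposedP /= H; apply/unexposedP => /=.
  case: H => [|[u' [l] [w] [ul wl wT ->]]]; first by left.
  by right; exists u', l, w; rewrite inE ul orbT.
- have sub0 a' b' : unexposed (DfsState d ((u, l) :: k) t a' b') \subset
                 unexposed (DfsState d ((u, w :: l) :: k) t a b).
    apply/subsetP => e /unexposedP /= H; apply/unexposedP => /=.
    case: H => [|[u' [l'] [w'] []]]; first by left.
    rewrite inE => /orP [/eqP [-> ->]|ul] wl wT ->; right.
      by exists u, (w :: l), w'; rewrite !inE eqxx wl orbT.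
    by exists u', l', w'; rewrite !inE ul orbT.
  case: ifPn => [_|/negPn wt]; first exact: sub0.
  case: ifP => _; last exact: sub0.
  apply: subset_trans (sub0 a b); apply/subsetP => e /unexposedP /= H.
  apply/unexposedP => /=.
  case: H => [[t1 [t2 [/setD1P [_ t1t] /setD1P [_ t2t] ->]]]|]; first by left; exists t1, t2.
  case=> u' [l'] [w'] []; rewrite inE => /orP [/eqP [-> ->]|].
    by rewrite mem_enum => /setD1P [_ w't] _ ->; left; exists w, w'.
  by move=> ul wl /setD1P [_ wT] ->; right; exists u', l', w'.
Qed.

Lemma dfs_step_det E E' st :
  E :&: unexposed st = E' :&: unexposed st -> dfs_step E st = dfs_step E' st.
Proof.
case: st => d k t a b EE'; rewrite /dfs_step; case: ifP => // _.
case: k EE' => [|[u [|w l]] k] // EE'; case: ifPn => // /negPn wt.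
suff -> : adj E u w = adj E' u w by [].
rewrite /adj; congr (_ && _); move/setP/(_ [set u; w]): EE'.
rewrite !inE; set P := (_ || _); suff -> : P by rewrite !andbT.
by rewrite /P /= wt eqxx orbT.
Qed.

Lemma dfs_run_det fuel st E E' :
  E :&: unexposed st = E' :&: unexposed st ->
  dfs_run E fuel st = dfs_run E' fuel st.
Proof.
elim: fuel st => [|f IH] st EE' //; rewrite !dfs_runS (dfs_step_det EE').
apply: IH; rewrite -(setIidPr (unexposed_step E' st)) !setIA.
by rewrite EE'.
Qed.

Variables (R : realFieldType) (p alpha beta : R).
Hypothesis mean1 : p * alpha + (1 - p) * beta = 1.

Definition dfs_weight st : R := alpha ^+ yes_count st * beta ^+ no_count st.

(** No pair is queried twice, so what follows a query is blind to the edge just exposed, and [mean1]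
    balances the two answers. *)
Lemma expect_dfs_weight fuel st : valid st ->
  expect (pairs n) p (fun E => dfs_weight (dfs_run E fuel st)) = dfs_weight st.
Proof.
elim: fuel st => [|f IH] st vst; first exact: (expect_cst (pairs n) p (dfs_weight st)).
(* Moves without a query neither depend on [E] nor change the weight. *)
have IH0 st' : valid st' -> dfs_weight st' = dfs_weight st ->
    (forall E, dfs_step E st = st') ->
    expect (pairs n) p (fun E => dfs_weight (dfs_run E f.+1 st)) = dfs_weight st.
  move=> v' <- H; rewrite -(IH _ v').
  by apply: eq_expect => E _; rewrite dfs_runS H.
case: st vst IH0 => d k t a b vst IH0.
case: (boolP (halted (DfsState d k t a b))) => [h|nh].
  by apply: (IH0 _ vst) => // E; rewrite dfs_step_halted.
have := fun E => step_valid E vst.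
move: IH0; rewrite /dfs_step (negPf nh).
case: k vst nh => [|[u [|w l]] k] vst nh.
- by case: pickP => [v vt|_] IH0 /(_ set0) vs; apply: (IH0 _ vs).
- by move=> IH0 /(_ set0) vs; apply: (IH0 _ vs).
case: (boolP (w \notin t)) => [wt|/negPn wt] IH0 vs; first by apply: (IH0 _ (vs set0)).
move=> {IH0}.
pose st1 := DfsState d ((w, enum (t :\ w)) :: (u, l) :: k) (t :\ w) a.+1 b.
pose st0 := DfsState d ((u, l) :: k) t a b.+1.
case: vst => uk kt lk sz; rewrite /= in uk kt lk sz.
have ut : u \notin t by apply: kt; rewrite inE eqxx.
have uw : u != w by apply: contraNneq ut => ->.
set e := [set u; w].
have adjE E : adj E u w = (e \in E) by rewrite /adj uw.
have v1 : valid st1 by have := vs setT; rewrite adjE inE.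
have v0 : valid st0 by have := vs set0; rewrite adjE inE.
have eU : e \in pairs n by rewrite inE cards2 uw.
have e1 : e \notin unexposed st1.
  apply/negP => /unexposedP /= [[t1 [t2 [/setD1P [_ t1t] /setD1P [_ t2t]]]]|].
    by move/setP/(_ u); rewrite !inE eqxx => /esym /orP [] /eqP E; rewrite E ?t1t ?t2t in ut.
  case=> u' [l'] [w'] [_ _ /setD1P [w'w w't]].
  move/setP/(_ w'); rewrite !inE eqxx orbT (negPf w'w) orbF => /eqP E.
  by rewrite -E w't in ut.
(* After a negative answer [w] has left the list of [u]; since neither that list nor the stack has
   duplicates, [e] cannot come back. *)
have e0 : e \notin unexposed st0.
  apply/negP => /unexposedP /= [[t1 [t2 [t1t t2t]]]|].
    by move/setP/(_ u); rewrite !inE eqxx => /esym /orP [] /eqP E; rewrite E ?t1t ?t2t in ut.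
  case=> u' [l'] [w'] [ul wl w't] E.
  have w'u : w' != u by apply: contraNneq ut => <-.
  have w'E : w' = w.
    by move/setP/(_ w'): E; rewrite !inE eqxx orbT (negPf w'u) => /eqP.
  subst w'.
  have uE : u = u'.
    by move/setP/(_ u): E; rewrite !inE eqxx (negPf uw) !orbF => /esym /eqP.
  subst u'; move: ul; rewrite inE => /orP [/eqP [ll]|ul].
    by move: lk wl; rewrite ll => /= /andP [/andP [/negPf ->]].
  have ku : u \in map fst k by apply/mapP; exists (u, l').
  by move: uk; rewrite /= ku.
have inv st' E : e \notin unexposed st' ->
    dfs_run (e |: E) f st' = dfs_run E f st' /\
    dfs_run (E :\ e) f st' = dfs_run E f st'.
  by move=> es; split; apply: dfs_run_det; apply/setP=> z; rewrite !inE;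
    case: eqP => //= -> ; rewrite !inE in es; rewrite (negPf es) !andbF.
have stepE E : dfs_step E (DfsState d ((u, w :: l) :: k) t a b) =
    if e \in E then st1 else st0.
  by rewrite /dfs_step (negPf nh) wt adjE.
rewrite (expect_avg _ _ eU).
transitivity (p * dfs_weight st1 + (1 - p) * dfs_weight st0); last first.
  rewrite /dfs_weight /= !exprS -[RHS]mul1r -[X in _ = X * _]mean1; ring.
rewrite -(IH _ v1) -(IH _ v0) -!expectZ -expectD; apply: eq_expect => E _.
rewrite /avg !dfs_runS !stepE !inE eqxx /=.
by rewrite (inv st1 E e1).1 (inv st0 E e0).2.
Qed.

Lemma init_valid : valid dfs_init.
Proof. by split=> //=; rewrite cardsT card_ord. Qed.

Lemma init_inv E : dfs_inv E dfs_init.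
Proof. by split=> //=; rewrite big_nil. Qed.

(* [alpha] per positive and [beta] per negative edge query make the weight a
   martingale; a run that never builds a long stack must end with [x] finished
   vertices, all of whose edges to unseen vertices were answered negatively. *)
Lemma expect_no_path : 0 <= p <= 1 -> 0 < alpha <= 1 -> 1 <= beta -> (x <= n)%N ->
  expect (pairs n) p (fun E => (~~ has_path E y)%:R) *
    (alpha ^+ (x + y) * beta ^+ (x * (n - x - y))) <= 1.
Proof.
move=> p01 /andP [a0 a1] b1 xn.
have W1 := expect_dfs_weight (dfs_measure dfs_init) init_valid.
rewrite /(dfs_weight dfs_init) /= mulr1 in W1.
rewrite mulrC -expectZ -[leRHS]W1; apply: ler_expect => // E _.
set st := dfs_run _ _ _.
have [vst ist] := dfs_run_inv (dfs_measure dfs_init) init_valid (init_inv E).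
have hst := dfs_run_halted E xn init_valid (leqnn _).
rewrite -/st in vst ist hst.
have b0 : 0 < beta by apply: lt_le_trans b1.
case: (boolP (has_path E y)) => hp /=.
  by rewrite mulr0 mulr_ge0 // exprn_ge0 // ltW.
rewrite mulr1 /dfs_weight.
case: vst ist => us kt _ sz [ps dx ya nb].
have ys : (size (stack st) < y)%N.
  rewrite ltnNge; apply: contraNN hp => ys.
  have szs : size (take y (map fst (stack st))) == y.
    by rewrite size_takel ?size_map.
  apply/existsP; exists (Tuple szs) => /=.
  by rewrite take_uniq // take_sorted.
have dE : done_count st = x.
  move: hst; rewrite /halted leqNgt [(y <= _)%N]leqNgt ys orbF -leqNgt => h.
  by apply/eqP; rewrite eqn_leq dx h.
apply: ler_pM; rewrite ?exprn_ge0 ?(ltW a0) ?(ltW b0) //.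
  by apply: ler_wiXn2l => //; rewrite ?(ltW a0) //; move: ya; rewrite dE; lia.
rewrite ler_weXn2l //; apply: leq_trans nb; rewrite dE.
apply: leq_trans (leq_addr _ _); rewrite leq_mul2l; apply/orP; right.
by move: sz; rewrite dE; move: #|_| => c; lia.
Qed.

End DepthFirstSearch.

(** * Connectors *)

(* Each such J contributes at least y^t to (1 + y)^#|X| = \sum_J y^#|J|. *)
Lemma card_small_sets (R : realFieldType) (X : finType) (t : nat) (y : R) :
  0 <= y <= 1 ->
  #|[set J : {set X} | (#|J| <= t)%N]|%:R * y ^+ t <= (1 + y) ^+ #|X|.
Proof.
move=> /andP [y0 y1].
have := @bigA_distr R 0 1 *%R +%R X (fun=> y) (fun=> 1).
rewrite prodr_const addrC => ->; rewrite mulr_natl -sumr_const.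
apply: le_trans (_ : \sum_(J in [set J : {set X} | (#|J| <= t)%N])
   \prod_i (if i \in J then y else 1) <= _).
  apply: ler_sum => J; rewrite inE => Jt.
  rewrite -big_mkcond prodr_const; exact: ler_wiXn2l.
rewrite [leRHS](bigID (fun J : {set X} => (#|J| <= t)%N)) /=.
rewrite (eq_bigl (fun J : {set X} => (#|J| <= t)%N)); last by move=> J; rewrite inE.
rewrite lerDl; apply: sumr_ge0 => J _; apply: prodr_ge0 => i _.
by case: ifP.
Qed.

Definition incident (I : eqType) (i : I) (e : I * I) := (i == e.1) || (i == e.2).

Definition max_degree_le k (J : {set 'I_k * 'I_k}) (d : nat) :=
  [forall i, #|[set e in J | incident i e]| <= d]%N.

Section Connectors.
Variables (R : realFieldType) (T : finType) (U : {set T}) (p : R).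
Variables (m k M : nat) (D : 'I_m -> 'I_k -> {set T}).
Hypothesis p01 : 0 <= p <= 1.
Hypothesis D_sub : forall q i, D q i \subset U.
Hypothesis D_disj : forall q i q' i', (q, i) != (q', i') ->
  [disjoint D q i & D q' i'].
Hypothesis D_card : forall q i, #|D q i| = M.

Implicit Types (E : {set T}) (e f : 'I_k * 'I_k) (J : {set 'I_k * 'I_k}) (Q : {set 'I_m}).

(** [D q i] stands for the potential edges between connector [q] and hub [i]. *)
Definition link E q i := ~~ [disjoint D q i & E].

Definition joins E q J := [exists e in J, link E q e.1 && link E q e.2].

Definition rho : R := 1 - (1 - p) ^+ M.

Lemma rho01 : 0 <= rho <= 1.
Proof.
case/andP: p01 => p0 p1; rewrite /rho subr_ge0 gerBl.
by rewrite exprn_ge0 ?subr_ge0 // exprn_ile1 ?subr_ge0 // gerBl.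
Qed.

Lemma det_by_link q i : det_by (D q i) (fun E => (link E q i)%:R : R).
Proof.
move=> E E' EE'; rewrite /link -!setI_eq0 (setIC _ E) (setIC _ E') EE'.
by [].
Qed.

Lemma expect_link q i : expect U p (fun E => (link E q i)%:R) = rho.
Proof.
rewrite /rho -(D_card q i) -(expect_disjoint p (D_sub q i)).
rewrite -[X in X - _](expect_cst U p) -expectB; apply: eq_expect => E _.
by rewrite /link; case: [disjoint _ & _]; rewrite ?subrr ?subr0.
Qed.

Lemma expect_links q (S : {set 'I_k}) :
  expect U p (fun E => \prod_(i in S) (link E q i)%:R) = rho ^+ #|S|.
Proof.
rewrite (@expect_prod _ _ _ _ _ _ (D q)).
- by rewrite -prodr_const; apply: eq_bigr => i _; rewrite expect_link.
- by move=> i _; apply: det_by_link.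
- by move=> i j _ _ ij; apply: D_disj; rewrite xpair_eqE eqxx.
Qed.

Definition hit E q (e : 'I_k * 'I_k) : R := (link E q e.1)%:R * (link E q e.2)%:R.

Lemma expect_hit q e : e.1 != e.2 -> expect U p (fun E => hit E q e) = rho ^+ 2.
Proof.
move=> e12; have <- : #|[set e.1; e.2]| = 2%N by rewrite cards2 e12.
rewrite -(expect_links q); apply: eq_expect => E _.
by rewrite big_setU1 ?inE //= big_set1.
Qed.

(** The product asks [q] to reach every hub of [e] or [f]. There are 2 of them when [e = f], at
    least 3 when distinct pairs share a hub, and 4 otherwise. *)
Lemma expect_hit2 q e f : (e.1 < e.2)%N -> (f.1 < f.2)%N ->
  expect U p (fun E => hit E q e * hit E q f) <=
    rho ^+ 2 * (e == f)%:R + rho ^+ 3 * (incident e.1 f || incident e.2 f)%:R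
    + rho ^+ 4.
Proof.
move=> e12 f12; have /andP [r0 r1] := rho01.
pose S := [set e.1; e.2] :|: [set f.1; f.2].
have -> : expect U p (fun E => hit E q e * hit E q f) = rho ^+ #|S|.
  rewrite -(expect_links q); apply: eq_expect => E _.
  have prodE (A : {set 'I_k}) :
     \prod_(i in A) (link E q i)%:R = [forall (i | i \in A), link E q i]%:R :> R.
    case: (boolP [forall (i | _), _]) => [/forall_inP H|].
      by rewrite big1 // => i /H ->.
    rewrite negb_forall_in => /exists_inP [i iA /negPf li].
    by rewrite (bigD1 i) //= li mul0r.
  rewrite prodE /hit -!natrM !mulnb; congr (nat_of_bool _)%:R.
  apply/idP/forall_inP => [/andP [/andP [a b] /andP [c d]] i|H].
    by rewrite !inE -orbA => /or4P [] /eqP ->.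
  by rewrite !H ?inE ?eqxx ?orbT.
have r2 : 0 <= rho ^+ 2 by rewrite exprn_ge0.
have r3 : 0 <= rho ^+ 3 by rewrite exprn_ge0.
have r4 : 0 <= rho ^+ 4 by rewrite exprn_ge0.
have e1e2 : e.1 != e.2 by rewrite neq_ltn e12.
have f1f2 : f.1 != f.2 by rewrite neq_ltn f12.
have S2 : (2 <= #|S|)%N.
  by apply: leq_trans (subset_leq_card (subsetUl _ _)); rewrite cards2 e1e2.
case: (eqVneq e f) => [ef|ef].
  rewrite mulr1 -addrA; apply: le_trans (_ : rho ^+ 2 <= _).
    exact: ler_wiXn2l.
  by rewrite lerDl addr_ge0 // mulr_ge0.
rewrite mulr0 add0r.
case: (boolP (incident e.1 f || incident e.2 f)) => inc.
  rewrite mulr1; apply: le_trans (_ : rho ^+ 3 <= _); last by rewrite lerDl.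
  apply: ler_wiXn2l => //; rewrite ltn_neqAle S2 andbT eq_sym.
  (* Pairs with the same two hubs coincide because both are listed in increasing order. *)
  apply: contraNneq ef => S_2.
  have Se : [set e.1; e.2] = S.
    by apply/eqP; rewrite eqEcard subsetUl S_2 cards2 e1e2.
  have Sf : [set f.1; f.2] = S.
    by apply/eqP; rewrite eqEcard subsetUr S_2 cards2 f1f2.
  have H i : (i \in [set e.1; e.2]) = (i \in [set f.1; f.2]) by rewrite Se Sf.
  have := H e.1; have := H e.2; rewrite !inE !eqxx orbT /=.
  case: e f e12 f12 {e1e2 f1f2 inc S S2 S_2 Se Sf H} => [a b] [c d] /= ab cd.
  move=> /esym /orP [] /eqP bE /esym /orP [] /eqP aE; subst a b => //.
  - by rewrite ltnn in ab.
  - by move: ab; rewrite ltnNge ltnW.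
  - by rewrite ltnn in ab.
rewrite mulr0 add0r; apply: ler_wiXn2l => //.
rewrite cardsU !cards2 e1e2 f1f2 (_ : _ :&: _ = set0) ?cards0 //.
apply/setP=> i; rewrite !inE; apply: contraNF inc => /andP [].
by rewrite /incident => /orP [] /eqP ->; move=> ->; rewrite ?orbT.
Qed.

(* The number Z of pairs of J that q links satisfies
   [Z = 0] <= 1 - (3 Z - Z^2) / 2, and the degree bound controls E Z^2. *)
Lemma expect_not_joins q J d : {in J, forall e, (e.1 < e.2)%N} ->
  max_degree_le J d -> d%:R * rho <= 4^-1 -> #|J|%:R * rho ^+ 2 <= 2^-1 ->
  expect U p (fun E => (~~ joins E q J)%:R) <= 1 - #|J|%:R * rho ^+ 2 / 2.
Proof.
move=> Jlt /forallP deg dr br; have /andP [r0 r1] := rho01.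
pose Z E := \sum_(e in J) hit E q e.
have hitE E e : hit E q e = (link E q e.1 && link E q e.2)%:R.
  by rewrite /hit -natrM mulnb.
have ZE E : Z E = #|[set e in J | link E q e.1 && link E q e.2]|%:R.
  rewrite -sum1_card natr_sum /Z big_mkcond [RHS]big_mkcond /=.
  by apply: eq_bigr => e _; rewrite hitE inE; case: (e \in J) => //=; case: (_ && _).
apply: le_trans (_ : expect U p (fun E => 1 - (3 * Z E - Z E * Z E) / 2) <= _).
  apply: ler_expect => // E _; case: (boolP (joins E q J)) => [_|nj] /=.
    rewrite ZE; set z := #|_|.
    (* For [z] linked pairs the right side is [(z - 1) * (z - 2) / 2], nonnegative at every natural
       number. *)
    have : (0 : R) <= ((z%:R - 1) * (z%:R - 2)) .
      case: z => [|[|[|z]]].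
      - by rewrite !sub0r mulrNN mul1r ler0n.
      - by rewrite subrr mul0r.
      - by rewrite subrr mulr0.
      - by rewrite mulr_ge0 // subr_ge0 ?ler1n // ler_nat.
    by move: (z%:R : R) => c; nra.
  rewrite /Z big1 ?mulr0 ?subr0 ?mul0r ?subr0 // => e eJ; rewrite hitE.
  move: nj; rewrite negb_exists_in => /forall_inP /(_ e eJ) /negPf ->.
  by [].
have EZ : expect U p Z = #|J|%:R * rho ^+ 2.
  rewrite /Z expect_sum mulr_natl -sumr_const; apply: eq_bigr => e eJ.
  by rewrite expect_hit // neq_ltn Jlt.
have EZ2 : expect U p (fun E => Z E * Z E) <=
    #|J|%:R * (rho ^+ 2 + 2 * d%:R * rho ^+ 3 + #|J|%:R * rho ^+ 4).
  have -> : expect U p (fun E => Z E * Z E) =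
     \sum_(e in J) \sum_(f in J) expect U p (fun E => hit E q e * hit E q f).
    under [RHS]eq_bigr => e _ do rewrite -expect_sum.
    rewrite -expect_sum; apply: eq_expect => E _.
    rewrite /Z big_distrl; apply: eq_bigr => e _.
    by rewrite big_distrr.
  rewrite mulr_natl -sumr_const; apply: ler_sum => e eJ.
  apply: le_trans (_ : \sum_(f in J) (rho ^+ 2 * (e == f)%:R +
     rho ^+ 3 * (incident e.1 f || incident e.2 f)%:R + rho ^+ 4) <= _).
    by apply: ler_sum => f fJ; apply: expect_hit2; apply: Jlt.
  rewrite !big_split /= sumr_const -(mulr_natl (rho ^+ 4)).
  apply: lerD => //; apply: lerD; rewrite -big_distrr /=.
    rewrite (bigD1 e) //= eqxx big1 ?addr0 ?mulr1 // => f /andP [_].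
    by rewrite eq_sym => /negPf ->.
  rewrite mulrC; apply: ler_wpM2r; first by rewrite exprn_ge0.
  rewrite -natr_sum -natrM ler_nat.
  (* At most [d] pairs of [J] pass through each end of [e]. *)
  apply: leq_trans (_ : \sum_(f in J) (incident e.1 f + incident e.2 f) <= _)%N.
    by apply: leq_sum => f _; do 2 case: (incident _ _).
  rewrite big_split /= mul2n -addnn.
  have cnt i : (\sum_(f in J) incident i f = #|[set f in J | incident i f]|)%N.
    rewrite -sum1_card big_mkcond [RHS]big_mkcond /=; apply: eq_bigr => f _.
    by rewrite inE; case: (f \in J); case: (incident i f).
  by rewrite !cnt leq_add.
rewrite expectB expect_cst.
have -> : expect U p (fun E => (3 * Z E - Z E * Z E) / 2) =
   2^-1 * (3 * expect U p Z - expect U p (fun E => Z E * Z E)).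
  by rewrite -expectZ -expectB -expectZ; apply: eq_expect => E _; rewrite mulrC.
rewrite EZ; move: EZ2 dr br; set b : R := #|J|%:R; set c : R := d%:R.
set z2 := expect _ _ _ => EZ2 dr br.
have b0 : 0 <= b by rewrite ler0n.
have r2 : 0 <= rho ^+ 2 by rewrite exprn_ge0.
(* The second moment is at most twice the mean, because [2 * d * rho] and [#|J| * rho ^ 2] are each
   at most one half. Hence [(3 Z - Z^2) / 2] has at least half the mean of [Z]. *)
have H : rho ^+ 2 + 2 * c * rho ^+ 3 + b * rho ^+ 4 <= 2 * rho ^+ 2.
  have -> : rho ^+ 2 + 2 * c * rho ^+ 3 + b * rho ^+ 4 =
     rho ^+ 2 * (1 + 2 * (c * rho) + b * rho ^+ 2) by ring.
  by rewrite [leRHS]mulrC; apply: ler_wpM2l => //; lra.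
have := ler_wpM2l b0 H; nra.
Qed.

Lemma det_by_joins q J :
  det_by (\bigcup_i D q i) (fun E => (~~ joins E q J)%:R : R).
Proof.
move=> E E' EE'; congr (~~ _)%:R; apply: eq_existsb => e.
suff lk i : link E q i = link E' q i by rewrite !lk.
have sub : D q i \subset \bigcup_i D q i by apply: (bigcup_sup i).
rewrite /link -!setI_eq0 (setIC _ E) (setIC _ E') -(setIidPr sub) !setIA.
by rewrite EE'.
Qed.

Lemma expect_none_joins Q J d : {in J, forall e, (e.1 < e.2)%N} ->
  max_degree_le J d -> d%:R * rho <= 4^-1 -> #|J|%:R * rho ^+ 2 <= 2^-1 ->
  expect U p (fun E => [forall (q | q \notin Q), ~~ joins E q J]%:R) <=
    (1 - #|J|%:R * rho ^+ 2 / 2) ^+ (m - #|Q|).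
Proof.
move=> Jlt deg dr br; have /andP [r0 r1] := rho01.
have -> : expect U p (fun E => [forall (q | q \notin Q), ~~ joins E q J]%:R) =
  expect U p (fun E => \prod_(q in ~: Q) (~~ joins E q J)%:R).
  apply: eq_expect => E _.
  case: (boolP [forall (i | _), _]) => [/forall_inP H|].
    by rewrite big1 // => i; rewrite inE => /H ->.
  rewrite negb_forall_in => /exists_inP [i iA /negPf li].
  by rewrite (bigD1 i) ?inE //= li mul0r.
rewrite (@expect_prod _ _ _ _ _ _ (fun q => \bigcup_i D q i)).
- have <- : #|~: Q| = (m - #|Q|)%N by rewrite cardsCs setCK card_ord.
  rewrite -prodr_const; apply: ler_prod => q _.
  rewrite (expect_not_joins q Jlt deg dr br) andbT.
  by apply: expect_ge0.
- by move=> q _; apply: det_by_joins.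
- move=> q q' _ _ qq'; apply: bigcup_disjoint => j _.
  rewrite disjoint_sym; apply: bigcup_disjoint => i _.
  by apply: D_disj; rewrite xpair_eqE eq_sym (negPf qq').
Qed.

(** Quantifying over all [J] and [Q] permits a greedy choice after the edges are revealed, when the
    pairs left and the connectors spent depend on [E]. *)
Definition expanding E (b d t : nat) :=
  [forall J : {set 'I_k * 'I_k}, forall Q : {set 'I_m},
    [&& #|J| == b, max_degree_le J d, [forall (e | e \in J), (e.1 < e.2)%N]
      & (#|Q| <= t)%N] ==> [exists q, (q \notin Q) && joins E q J]].

Lemma expect_not_expanding b d t :
  d%:R * rho <= 4^-1 -> b%:R * rho ^+ 2 <= 2^-1 ->
  expect U p (fun E => (~~ expanding E b d t)%:R) <=
    #|[set J : {set 'I_k * 'I_k} | #|J| <= b]%N|%:R *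
    #|[set Q : {set 'I_m} | #|Q| <= t]%N|%:R *
    (1 - b%:R * rho ^+ 2 / 2) ^+ (m - t).
Proof.
move=> dr br; have /andP [r0 r1] := rho01.
have q01 : 0 <= 1 - b%:R * rho ^+ 2 / 2 <= 1.
  have : 0 <= b%:R * rho ^+ 2 by rewrite mulr_ge0 ?exprn_ge0.
  by move: br; move: (b%:R * _) => z; lra.
pose okJ (J : {set 'I_k * 'I_k}) := [&& #|J| == b, max_degree_le J d &
   [forall (e | e \in J), (e.1 < e.2)%N]].
apply: le_trans (_ : expect U p (fun E => \sum_(J | okJ J)
   \sum_(Q : {set 'I_m} | (#|Q| <= t)%N)
     [forall (q | q \notin Q), ~~ joins E q J]%:R) <= _).
  apply: ler_expect => // E _; case: (boolP (expanding E b d t)) => /= [_|].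
    by apply: sumr_ge0 => J _; apply: sumr_ge0 => Q _.
  rewrite negb_forall => /existsP [J]; rewrite negb_forall => /existsP [Q].
  rewrite negb_imply => /andP [/and4P [Jb Jd Jl Qt]].
  rewrite negb_exists => /forallP H.
  rewrite (bigD1 J) /=; last by rewrite /okJ Jb Jd Jl.
  rewrite (bigD1 Q) //= (_ : [forall (q | _), _] = true); last first.
    by apply/forall_inP => q qQ; move: (H q); rewrite qQ.
  rewrite -addrA lerDl addr_ge0 //; first by apply: sumr_ge0.
  by apply: sumr_ge0 => J' _; apply: sumr_ge0.
rewrite expect_sum.
apply: le_trans (_ : \sum_(J in [set J : {set 'I_k * 'I_k} | #|J| <= b]%N)
   \sum_(Q in [set Q : {set 'I_m} | #|Q| <= t]%N)
     (1 - b%:R * rho ^+ 2 / 2) ^+ (m - t) <= _); last first.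
  by rewrite !sumr_const -[X in X *+ _]mulr_natl -[X in X <= _]mulr_natl mulrA.
rewrite [leRHS](bigID okJ) /=.
rewrite -[leLHS]addr0; apply: lerD; last first.
  apply: sumr_ge0 => J _; apply: sumr_ge0 => Q _.
  by rewrite exprn_ge0 //; case/andP: q01.
rewrite [leRHS](eq_bigl okJ) => [|J]; last first.
  rewrite inE; apply/idP/idP => [/andP [] //|H]; rewrite H andbT.
  by case/and3P: H => /eqP ->.
apply: ler_sum => J /and3P [/eqP Jb Jd /forall_inP Jl].
rewrite expect_sum; rewrite [leRHS](eq_bigl (fun Q : {set 'I_m} => #|Q| <= t)%N);
  last by move=> Q; rewrite inE.
apply: ler_sum => Q Qt.
apply: le_trans (expect_none_joins Q Jl Jd dr _) _; first by rewrite Jb.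
by rewrite Jb; case/andP: q01 => ? ?; apply: ler_wiXn2l => //; apply: leq_sub2l.
Qed.

End Connectors.

Local Close Scope ring_scope.

(** * Matching pairs to connectors *)

Section Matching.
Variable k : nat.
Implicit Types (e : 'I_k * 'I_k) (J : {set 'I_k * 'I_k}) (A : {set 'I_k}).

Definition ordered J := [forall (e | e \in J), (e.1 < e.2)%N].

Lemma max_degree_leS J J' d : J \subset J' -> max_degree_le J' d -> max_degree_le J d.
Proof.
move=> JJ' /forallP H; apply/forallP => i; apply: leq_trans (H i).
apply: subset_leq_card; apply/subsetP => e; rewrite !inE => /andP [eJ ->].
by rewrite (subsetP JJ').
Qed.

Lemma orderedS J J' : J \subset J' -> ordered J' -> ordered J.
Proof.
move=> JJ' /forall_inP H; apply/forall_inP => e eJ.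
by apply: H; apply: (subsetP JJ').
Qed.

Definition joined (con : nat -> 'I_k -> bool) q e := con q e.1 && con q e.2.

(** Connectors are plain numbers here, so that rounds with different [m] share one type of
    assignment. *)
Definition has_connectors (con : nat -> 'I_k -> bool) m b d t :=
  forall J (Q : {set 'I_m}), #|J| = b -> max_degree_le J d -> ordered J ->
    #|Q| <= t -> exists q e, [/\ q \notin Q, e \in J & joined con (val q) e].

(** Greedy matching: while [b] pairs of [J] are unmatched, the connectors in use number at most
    [#|J| <= t], so a fresh one links one of these pairs. *)
Lemma one_round con m b d t J :
  has_connectors con m b d t ->
  #|J| <= t -> max_degree_le J d -> ordered J ->
  exists (J1 : {set 'I_k * 'I_k}) (f : 'I_k * 'I_k -> nat),
    [/\ J1 \subset J, {in J1, forall e, f e < m /\ joined con (f e) e},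
        {in J1 &, injective f} & #|J :\: J1| < b].
Proof.
move=> Hcon Jt Jd Jo.
pose good (J1 : {set 'I_k * 'I_k}) (f : 'I_k * 'I_k -> nat) :=
  [/\ J1 \subset J, {in J1, forall e, f e < m /\ joined con (f e) e} &
      {in J1 &, injective f}].
(* Either the goal is reached or some matching has exactly [j] pairs; the latter is impossible at
   [j = #|J| + 1]. *)
have step j : (exists J1 f, [/\ J1 \subset J, good J1 f & #|J :\: J1| < b]) \/
    (exists J1 f, good J1 f /\ #|J1| = j).
  elim: j => [|j [|[J1 [f [[J1J fJ finj] J1j]]]]].
  - right; exists set0, (fun=> 0); split; last by rewrite cards0.
    by split=> [|e|e e']; rewrite ?sub0set ?inE.
  - by left.
  case: (ltnP #|J :\: J1| b) => [lt|bJ]; first by left; exists J1, f.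
  right.
  have [J2 J2sub J2b] : exists2 J2 : {set 'I_k * 'I_k}, J2 \subset J :\: J1 & #|J2| = b.
    have [s [us sb sJ]] : exists s, [/\ uniq s, size s = b & {subset s <= J :\: J1}].
      exists (take b (enum (J :\: J1))); split.
      - by rewrite take_uniq ?enum_uniq.
      - by rewrite size_takel // -cardE.
      - by move=> e /mem_take; rewrite mem_enum.
    exists [set e in s]; first by apply/subsetP => e; rewrite inE => /sJ.
    by rewrite cardsE (card_uniqP us).
  have J2J : J2 \subset J by apply: subset_trans J2sub (subsetDl _ _).
  pose Q := [set q : 'I_m | val q \in map f (enum J1)].
  have Qt : #|Q| <= t.
    apply: leq_trans Jt; apply: leq_trans (subset_leq_card J1J).
    rewrite cardE -(size_map val) cardE -(size_map f).
    apply: uniq_leq_size; first by rewrite map_inj_uniq ?enum_uniq //; apply: val_inj.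
    by move=> z /mapP [q]; rewrite mem_enum /Q inE => H zE; rewrite zE.
  have [q [e [qQ eJ2 qe]]] := Hcon J2 Q J2b (max_degree_leS J2J Jd) (orderedS J2J Jo) Qt.
  have eJ1 : e \notin J1 by move/subsetP/(_ e eJ2): J2sub; rewrite inE => /andP [].
  have qf e' : e' \in J1 -> f e' != val q.
    move=> e'J; apply: contraNneq qQ => fe'.
    by rewrite inE -fe' map_f ?mem_enum.
  exists (e |: J1), (fun e' => if e' == e then val q else f e').
  split; last by rewrite cardsU1 eJ1 J1j.
  split.
  - by rewrite subUset sub1set (subsetP J2J) //.
  - move=> e'; rewrite !inE; case: eqP => [-> _|_ /= /fJ] //.
    by split; [apply: ltn_ord | apply: qe].
  - move=> e1 e2; rewrite !inE.
    case: (eqVneq e1 e) => [->|e1e] /=; case: (eqVneq e2 e) => [->|e2e] //=.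
    + by move=> _ e2J /eqP; rewrite eq_sym (negPf (qf _ e2J)).
    + by move=> e1J _ /eqP; rewrite (negPf (qf _ e1J)).
    + exact: finj.
case: (step #|J|.+1) => [[J1 [f [_ [J1J fJ finj] lt]]]|[J1 [f [[J1J _ _] J1c]]]].
  by exists J1, f.
by have := subset_leq_card J1J; rewrite J1c ltnn.
Qed.

Definition pairs_in A := [set e : 'I_k * 'I_k | [&& e.1 \in A, e.2 \in A & e.1 < e.2]].

(** Double counting: the degrees add up to [2 * #|J|]. *)
Lemma few_high_degree J d h : ordered J -> 2 * #|J| <= h * d -> 0 < d ->
  #|[set i | d < #|[set e in J | incident i e]|]| <= h.
Proof.
move=> /forall_inP Jo Jh d0; set B := [set i | _].
rewrite -(leq_pmul2r d0); apply: leq_trans Jh.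
have -> : 2 * #|J| = \sum_i #|[set e in J | incident i e]|.
  transitivity (\sum_(e in J) \sum_i incident i e).
    rewrite mulnC -sum_nat_const; apply: eq_bigr => e eJ.
    have e12 : e.1 != e.2 by rewrite neq_ltn Jo.
    rewrite (bigD1 e.1) // (bigD1 e.2) 1?eq_sym //= /incident !eqxx orbT.
    rewrite big1 // => i /andP [/negPf i1 /negPf i2].
    by rewrite i1 i2.
  rewrite exchange_big /=; apply: eq_bigr => i _.
  rewrite -sum1_card big_mkcond [RHS]big_mkcond /=; apply: eq_bigr => e _.
  by rewrite inE; case: (e \in J); case: (incident i e).
rewrite -sum_nat_const [leqRHS](bigID (mem B)) /=.
apply: leq_trans (leq_addr _ _); apply: leq_sum => i.
by rewrite inE => /ltnW.
Qed.

Definition linked (con : nat -> nat -> 'I_k -> bool) (x : nat * nat) e :=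
  joined (con x.1) x.2 e.

(** [A] is the set of surviving hubs, [J] the pairs still unlinked, and [g] the connector of every
    other pair. Tagging a connector by its round keeps the rounds apart in the injectivity of
    [g]. *)
Lemma rounds (con : nat -> nat -> 'I_k -> bool) (m b d h : nat -> nat) Rn :
  (forall r, r < Rn -> has_connectors (con r) (m r) (b r.+1) (d r) (b r)) ->
  (forall r, r < Rn -> 2 * b r <= h r * d r /\ 0 < d r) ->
  k * k <= b 0 -> 0 < k ->
  exists A (J : {set 'I_k * 'I_k}) (g : 'I_k * 'I_k -> nat * nat),
    [/\ J \subset pairs_in A, #|J| < b Rn,
        {in pairs_in A :\: J, forall e,
           [/\ (g e).1 < Rn, (g e).2 < m (g e).1 & linked con (g e) e]},
        {in pairs_in A :\: J &, injective g} &
        k <= #|A| + \sum_(r < Rn) h r].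
Proof.
move=> Hcon Hd kb k0; elim: Rn Hcon Hd => [|Rn IH] Hcon Hd.
  exists setT, (pairs_in setT), (fun=> (0, 0)); split => //.
  (* The diagonal is missing from [pairs_in setT], which makes the inequality strict. *)
  - apply: leq_trans kb; rewrite -[X in X * X]card_ord -card_prod -cardsT.
    apply: proper_card; apply/properP; split; first exact: subsetT.
    exists (Ordinal k0, Ordinal k0); first by rewrite inE.
    by rewrite !inE.
  - by move=> e; rewrite setDv inE.
  - by move=> e e'; rewrite setDv inE.
  - by rewrite big_ord0 addn0 cardsT card_ord.
have [||A [J [g [JA Jb gJ ginj kA]]]] := IH.
- by move=> r rR; apply: Hcon; apply: ltnW.
- by move=> r rR; apply: Hd; apply: ltnW.
have [hd d0] := Hd Rn (ltnSn Rn).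
have Jo : ordered J.
  apply/forall_inP => e /(subsetP JA); rewrite inE => /and3P [] //.
pose B := [set i | d Rn < #|[set e in J | incident i e]|].
have Bh : #|B| <= h Rn.
  apply: few_high_degree => //; apply: leq_trans hd.
  by rewrite leq_mul2l ltnW.
(* Dropping the hubs with too many unlinked pairs bounds the degrees for this round; pairs that lose
   a hub are abandoned. *)
pose A' := A :\: B.
pose J' := J :&: pairs_in A'.
have J'J : J' \subset J by apply: subsetIl.
have J'b : #|J'| <= b Rn by apply: leq_trans (subset_leq_card J'J) (ltnW Jb).
have J'd : max_degree_le J' (d Rn).
  apply/forallP => i; case: (boolP (i \in A')) => iA.
    have iAA : i \in A by move: iA; rewrite inE => /andP [].
    move: iA; rewrite !inE iAA andbT -leqNgt => H.
    apply: leq_trans H; apply: subset_leq_card; apply/subsetP => e.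
    by rewrite !inE => /andP [/andP [-> _] ->].
  rewrite (_ : [set e in J' | _] = set0) ?cards0 //.
  apply/setP=> e; rewrite [RHS]inE inE /J' inE; apply: contraNF iA.
  rewrite /pairs_in inE => /andP [/andP [_ /and3P [e1 e2 _]]].
  by rewrite /incident => /orP [] /eqP ->.
have J'o : ordered J' by apply: orderedS Jo.
have [J1 [f [J1J' fJ1 finj lt]]] := one_round (Hcon Rn (ltnSn Rn)) J'b J'd J'o.
pose g' e := if e \in J1 then (Rn, f e) else g e.
have cover e : e \in pairs_in A' :\: (J' :\: J1) -> e \notin J1 ->
    e \in pairs_in A :\: J.
  rewrite !inE => /andP [H /and3P [/andP [e1B e1A] /andP [e2B e2A] e12]] eJ1.
  move: H; rewrite e1B e1A e2B e2A e12 eJ1 /= !andbT => eJ.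
  by rewrite eJ.
exists A', (J' :\: J1), g'; split => //.
- by apply: subset_trans (subsetDl _ _) (subsetIr _ _).
- move=> e eA; rewrite /g'; case: (boolP (e \in J1)) => eJ1 /=.
    by have [fm fc] := fJ1 e eJ1; split.
  have [gR gm gc] := gJ e (cover e eA eJ1).
  by split=> //; apply: leq_trans gR _.
- have lR e : e \in pairs_in A' :\: (J' :\: J1) -> e \notin J1 -> (g e).1 < Rn.
    by move=> eA eJ1; have [] := gJ e (cover e eA eJ1).
  move=> e e' eA e'A; rewrite /g'.
  case: (boolP (e \in J1)) => eJ1; case: (boolP (e' \in J1)) => e'J1.
  + by move=> [] /finj; apply.
  + by move=> E; have := lR e' e'A e'J1; rewrite -E ltnn.
  + by move=> E; have := lR e eA eJ1; rewrite E ltnn.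
  + by apply: ginj; apply: cover.
- have AA' : #|A| <= #|A'| + h Rn.
    rewrite -(cardsID B A) addnC leq_add2l; apply: leq_trans Bh.
    by apply: subset_leq_card; apply: subsetIr.
  rewrite big_ord_recr /=; apply: leq_trans kA _.
  by rewrite (addnC _ (h Rn)) addnA leq_add2r.
Qed.

End Matching.

(** * Minors from linked blocks *)

Section Minors.
Variable n : nat.
Implicit Types (E : {set {set 'I_n}}) (X Y S : {set 'I_n}) (s : seq 'I_n).

Definition touching E X Y := [exists u in X, exists v in Y, adj E u v].

Lemma touchingP E X Y :
  reflect (exists u v, [/\ u \in X, v \in Y & adj E u v]) (touching E X Y).
Proof.
apply: (iffP exists_inP) => [[u uX /exists_inP [v vY uv]]|[u [v [uX vY uv]]]].
  by exists u, v.
by exists u => //; apply/exists_inP; exists v.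
Qed.

Lemma touching_sym E X Y : touching E X Y = touching E Y X.
Proof.
by apply/touchingP/touchingP => -[u [v [uX vY uv]]]; exists v, u; rewrite adjC.
Qed.

Lemma touchingS E E' X X' Y Y' : E \subset E' -> X \subset X' -> Y \subset Y' ->
  touching E X Y -> touching E' X' Y'.
Proof.
move=> EE XX YY /touchingP [u [v [uX vY /andP [uv e]]]]; apply/touchingP.
exists u, v; split; rewrite ?(subsetP XX) ?(subsetP YY) //.
by rewrite /adj uv (subsetP EE).
Qed.

Definition restr E S := fun x y => [&& x \in S, y \in S & adj E x y].

Lemma restr_sym E S : connect_sym (restr E S).
Proof.
apply: sym_connect_sym => x y.
by rewrite /restr adjC andbCA.
Qed.

Lemma connected_inS E E' S : E \subset E' -> connected_in E S -> connected_in E' S.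
Proof.
move=> EE /andP [S0 /forall_inP H]; apply/andP; split=> //.
apply/forall_inP => u uS.
apply/forall_inP => v vS; move/forall_inP/(_ v vS): (H u uS).
apply: connect_sub => x y /and3P [xS yS /andP [xy e]]; apply: connect1.
by rewrite xS yS /adj xy (subsetP EE).
Qed.

Lemma connected_inU E X Y :
  connected_in E X -> connected_in E Y -> touching E X Y ->
  connected_in E (X :|: Y).
Proof.
case/andP=> X0 /forall_inP cX /andP [Y0 /forall_inP cY].
case/touchingP=> u0 [v0 [uX vY uv]].
have lift (Z : {set 'I_n}) x y : Z \subset X :|: Y -> connect (restr E Z) x y ->
    connect (restr E (X :|: Y)) x y.
  move=> sub; apply: connect_sub => a b /and3P [aZ bZ ab]; apply: connect1.
  by rewrite /restr !(subsetP sub).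
have to_u0 x : x \in X :|: Y -> connect (restr E (X :|: Y)) u0 x.
  rewrite inE => /orP [xX|xY].
    by apply: (lift X); [apply: subsetUl | move/forall_inP: (cX u0 uX); apply].
  apply: connect_trans (_ : connect _ v0 _).
    by apply: connect1; rewrite /restr !inE uX vY orbT.
  by apply: (lift Y); [apply: subsetUr | move/forall_inP: (cY v0 vY); apply].
apply/andP; split; first by apply/set0Pn; exists u0; rewrite inE uX.
apply/forall_inP => x xU; apply/forall_inP => y yU.
apply: connect_trans (to_u0 y yU); rewrite restr_sym; exact: to_u0.
Qed.

Lemma connected_in_star E (I : Type) (r : seq I) (P : pred I) (X : I -> {set 'I_n}) S :
  connected_in E S ->
  (forall i, P i -> connected_in E (X i) /\ touching E (X i) S) ->
  connected_in E (S :|: \bigcup_(i <- r | P i) X i).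
Proof.
move=> cS cX; elim: r => [|i r IH]; first by rewrite big_nil setU0.
rewrite big_cons; case: ifP => // Pi; have [ci ti] := cX i Pi.
rewrite setUCA; apply: connected_inU => //.
by apply: touchingS ti => //; apply: subsetUl.
Qed.

Lemma connected_in_path E s : s != [::] -> sorted (adj E) s ->
  connected_in E [set v in s].
Proof.
case: s => // v s _ /= pv; apply/andP; split.
  by apply/set0Pn; exists v; rewrite !inE eqxx.
have from_v x : x \in v :: s -> connect (restr E [set z in v :: s]) v x.
  move=> xs; apply: (@path_connect _ (restr E [set z in v :: s]) v s) => //.
  apply: (@sub_in_path _ (mem (v :: s)) (adj E)) pv; last by apply/allP.
  by move=> a b aS bS ab; apply/and3P; split; rewrite ?in_set.
apply/forall_inP => x; rewrite inE => xS; apply/forall_inP => y; rewrite inE => yS.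
apply: connect_trans (from_v y yS); rewrite restr_sym; exact: from_v.
Qed.

(** The connector of a pair [(i, j)] with [i < j] is absorbed into the branch set of [i] and still
    touches hub [j]. Injectivity of [g] keeps the branch sets disjoint. *)
Lemma has_K_minor_links E k (S : 'I_k -> {set 'I_n}) (Q : nat * nat -> {set 'I_n})
    (ok : pred (nat * nat)) (A : {set 'I_k}) (g : 'I_k * 'I_k -> nat * nat) :
  (forall i, connected_in E (S i)) ->
  (forall x, ok x -> connected_in E (Q x)) ->
  (forall i j, i != j -> [disjoint S i & S j]) ->
  (forall x y, ok x -> ok y -> x != y -> [disjoint Q x & Q y]) ->
  (forall i x, ok x -> [disjoint S i & Q x]) ->
  {in pairs_in A, forall e, [/\ ok (g e), touching E (Q (g e)) (S e.1)
     & touching E (Q (g e)) (S e.2)]} ->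
  {in pairs_in A &, injective g} ->
  has_K_minor E #|A|.
Proof.
move=> cS cQ dS dQ dSQ lk ginj.
pose B (i : 'I_k) := S i :|: \bigcup_(j | (i, j) \in pairs_in A) Q (g (i, j)).
have dB i j : i \in A -> j \in A -> i != j -> [disjoint B i & B j].
  move=> iA jA ij; rewrite -setI_eq0; apply/eqP/setP => v; rewrite !inE.
  apply/negP => /andP [vi vj].
  case/orP: vi => [vSi|/bigcupP [i' ii' vi]]; case/orP: vj => [vSj|/bigcupP [j' jj' vj]].
  - by rewrite (disjointFr (dS i j ij) vSi) in vSj.
  - have [okj _ _] := lk _ jj'.
    by rewrite (disjointFr (dSQ i _ okj) vSi) in vj.
  - have [oki _ _] := lk _ ii'.
    by rewrite (disjointFr (dSQ j _ oki) vSj) in vi.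
  - have [oki _ _] := lk _ ii'; have [okj _ _] := lk _ jj'.
    have gg : g (i, i') != g (j, j').
      apply: contraNneq ij => gE.
      by have [-> _] : (i, i') = (j, j') by apply: ginj.
    by rewrite (disjointFr (dQ _ _ oki okj gg) vi) in vj.
have tB i j : i \in A -> j \in A -> i != j -> touching E (B i) (B j).
  have tB' a b : a \in A -> b \in A -> a < b -> touching E (B a) (B b).
    move=> aA bA ab; have abA : (a, b) \in pairs_in A by rewrite inE /= aA bA ab.
    have [_ _ t] := lk _ abA; apply: touchingS t => //; last exact: subsetUl.
    apply: subset_trans (subsetUr _ _).
    by apply: (bigcup_sup b).
  move=> iA jA; rewrite neq_ltn => /orP [ij|ji]; first exact: tB'.
  by rewrite touching_sym; apply: tB'.
have cB i : connected_in E (B i).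
  apply: connected_in_star => // j ij; have [okg t1 _] := lk _ ij.
  by split => //; apply: cQ.
pose a (h : 'I_#|A|) := enum_val h.
have aA h : a h \in A by apply: enum_valP.
apply/existsP; exists [ffun h => B (a h)]; apply/andP; split.
  by apply/forallP => h; rewrite ffunE.
apply/forallP => h; apply/forallP => h'; apply/implyP => hh'.
have ah : a h != a h' by apply: contraNneq hh' => /enum_val_inj ->.
rewrite !ffunE dB //=; exact: tB.
Qed.

Lemma has_K_minor_le E k : has_K_minor E k -> k <= n.
Proof.
case/existsP=> B /andP [/forallP cB /forallP dB].
have rep h : exists v, v \in B h by apply/set0Pn; case/andP: (cB h).
pose f h := xchoose (rep h).
have fB h : f h \in B h by apply: xchooseP.
have finj : injective f.
  move=> h h' fE; apply/eqP/negPn/negP => hh'.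
  move/forallP/(_ h')/implyP/(_ hh')/andP: (dB h) => [d _].
  by move: (fB h'); rewrite -fE (disjointFr d (fB h)).
by have := leq_card f finj; rewrite !card_ord.
Qed.

Lemma ccl_ge E k : has_K_minor E k -> k <= ccl E.
Proof.
move=> H; have kn1 : k < n.+1 by rewrite ltnS (has_K_minor_le H).
by apply: (@leq_bigmax_cond _ (fun k : 'I_n.+1 => has_K_minor E k) val (Ordinal kn1)).
Qed.

Lemma has_K_minor_ccl E : has_K_minor E (ccl E).
Proof.
(* The trivial minor on no vertices makes the range of the maximum nonempty, so the maximum is
   attained. *)
have K0 : has_K_minor E (@ord0 n).
  by apply/existsP; exists [ffun=> set0]; apply/andP; split; apply/forallP => -[].
have [|i iK iE] := @eq_bigmax_cond _ (fun k : 'I_n.+1 => has_K_minor E k) val.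
  by apply/card_gt0P; exists ord0.
have -> : ccl E = i by exact: iE.
exact: iK.
Qed.

(** One edge is chosen between each two branch sets. An edge determines the branch sets of its ends,
    so the choice is injective. *)
Lemma minor_edges E k : has_K_minor E k -> k * k.-1 <= 2 * #|E|.
Proof.
case/existsP=> B /andP [/forallP cB /forallP dB].
have disj h h' : h != h' -> [disjoint B h & B h'].
  by move=> hh'; move/forallP/(_ h')/implyP/(_ hh')/andP: (dB h) => [].
have edge h h' : h != h' -> exists e, exists u v,
    [/\ u \in B h, v \in B h', e = [set u; v] & e \in E].
  move=> hh'; move/forallP/(_ h')/implyP/(_ hh')/andP: (dB h) => [_].
  by case/touchingP=> u [v [uB vB /andP [uv e]]]; exists [set u; v], u, v.
pose P := [set e : 'I_k * 'I_k | e.1 < e.2].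
(* The default [set0] is never taken on [P], as [fP] shows. *)
pose f (e : 'I_k * 'I_k) : {set 'I_n} := odflt set0
  [pick X in E | [exists u in B e.1, exists v in B e.2, X == [set u; v]]].
have fP e : e \in P -> f e \in E /\ exists u v,
    [/\ u \in B e.1, v \in B e.2 & f e = [set u; v]].
  rewrite inE => e12; have ne : e.1 != e.2 by rewrite neq_ltn e12.
  rewrite /f; case: pickP => [X /andP [XE /exists_inP [u uB /exists_inP [v vB /eqP X_E]]]|no].
    by split=> //; exists u, v.
  have [X [u [v [uB vB XE XinE]]]] := edge _ _ ne.
  move: (no X); rewrite XinE /= => /negbT/negP []; apply/exists_inP; exists u => //.
  by apply/exists_inP; exists v => //; apply/eqP.
have own v h h' : v \in B h -> v \in B h' -> h = h'.
  move=> vh vh'; apply/eqP; apply/negPn/negP => hh'.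
  by rewrite (disjointFr (disj _ _ hh') vh) in vh'.
have finj : {in P &, injective f}.
  move=> e e' eP e'P fE.
  have [_ [u [v [uB vB Ee]]]] := fP e eP; have [_ [u' [v' [uB' vB' Ee']]]] := fP e' e'P.
  have H : [set u; v] = [set u'; v'] by rewrite -Ee -Ee' fE.
  have u_in : u \in [set u'; v'] by rewrite -H !inE eqxx.
  have v_in : v \in [set u'; v'] by rewrite -H !inE eqxx orbT.
  move: eP e'P; rewrite !inE; case: e e' {fE Ee Ee'} uB vB uB' vB' => [a b] [c d] /=.
  move=> uB vB uB' vB' ab cd.
  case/set2P: u_in => uE; rewrite uE in uB; case/set2P: v_in => vE; rewrite vE in vB.
  - by move: ab; rewrite (own _ _ _ uB vB) ltnn.
  - by rewrite (own _ _ _ uB uB') (own _ _ _ vB vB').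
  - move: ab; rewrite (own _ _ _ uB vB') (own _ _ _ vB uB') => dc.
    by move: cd; rewrite ltnNge ltnW.
  - by move: ab; rewrite (own _ _ _ uB vB) ltnn.
have PE : #|P| <= #|E|.
  rewrite -(card_in_imset finj); apply: subset_leq_card.
  by apply/subsetP => X /imsetP [e eP ->]; have [] := fP e eP.
have -> : k * k.-1 = 2 * #|P|.
  have := mul_bin_diag k 1; rewrite bin1 => ->; rewrite -bin2_sum; congr (_ * _).
  rewrite -sum1_card (eq_bigl (fun e : 'I_k * 'I_k => e.1 < e.2)); last first.
    by move=> e; rewrite inE.
  rewrite -(pair_big_dep xpredT (fun i j : 'I_k => i < j) (fun _ _ => 1)) /=.
  rewrite (exchange_big_dep xpredT) //= big_mkord; apply: eq_bigr => j _.
  by rewrite -(big_ord_widen k (fun=> 1)) ?sum1_card ?card_ord // ltnW.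
by rewrite leq_mul2l PE.
Qed.

End Minors.

(** * Blocks of a path *)

Section Blocks.
Variables (n : nat).
Implicit Types (E : {set {set 'I_n}}) (X Y : {set 'I_n}) (s : seq 'I_n).

Definition block s o l : {set 'I_n} := [set v in take l (drop o s)].

Lemma block_index s o l v : uniq s -> v \in block s o l ->
  o <= index v s < o + l.
Proof.
move=> us; rewrite inE => vb; set j := index v (take l (drop o s)).
have jl : j < size (take l (drop o s)) by rewrite index_mem.
have vE : v = nth v s (o + j).
  rewrite -nth_drop -[RHS](nth_take (n0 := l)); first by rewrite nth_index.
  by move: jl; rewrite size_take; case: ifP => //; lia.
move: jl; rewrite size_take size_drop => jl.
have jl' : j < l /\ o + j < size s by move: jl; case: ifP; lia.
by rewrite {1 2}vE index_uniq ?(proj2 jl') // leq_addr ltn_add2l (proj1 jl').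
Qed.

Lemma block_disjoint s o l o' l' : uniq s -> (o + l <= o') || (o' + l' <= o) ->
  [disjoint block s o l & block s o' l'].
Proof.
move=> us H; rewrite -setI_eq0; apply/eqP/setP => v; rewrite [RHS]inE inE.
apply/negP => /andP [/(block_index us) b1 /(block_index us) b2].
by move: H b1 b2; lia.
Qed.

Lemma card_block s o l : uniq s -> o + l <= size s -> #|block s o l| = l.
Proof.
move=> us ol; rewrite cardsE; have /card_uniqP -> : uniq (take l (drop o s)).
  by rewrite take_uniq ?drop_uniq.
rewrite size_takel // size_drop leq_subRL //; exact: leq_trans (leq_addr _ _) ol.
Qed.

Lemma block_connected E s o l : sorted (adj E) s -> 0 < l -> o + l <= size s ->
  connected_in E (block s o l).
Proof.
move=> ss l0 ol; apply: connected_in_path; last by rewrite take_sorted ?drop_sorted.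
rewrite -size_eq0 size_takel -?lt0n // size_drop leq_subRL //.
exact: leq_trans (leq_addr _ _) ol.
Qed.

Definition cross X Y : {set {set 'I_n}} := [set [set e.1; e.2] | e in setX X Y].

(** The two disjointness hypotheses exclude that the ends are matched crosswise. *)
Lemma cross_inj X Y X' Y' (u v u' v' : 'I_n) :
  [disjoint X & Y'] -> [disjoint X' & Y] ->
  u \in X -> v \in Y -> u' \in X' -> v' \in Y' -> [set u; v] = [set u'; v'] ->
  u = u' /\ v = v'.
Proof.
move=> d1 d2 uX vY uX' vY' E.
have : u \in [set u'; v'] by rewrite -E !inE eqxx.
have : v \in [set u'; v'] by rewrite -E !inE eqxx orbT.
case/set2P=> vE; case/set2P=> uE => //.
- by rewrite -vE in uX'; rewrite (disjointFr d2 uX') in vY.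
- by rewrite -vE in uX'; rewrite (disjointFr d2 uX') in vY.
- by rewrite -uE in vY'; rewrite (disjointFr d1 uX) in vY'.
Qed.

Lemma card_cross X Y : [disjoint X & Y] -> #|cross X Y| = #|X| * #|Y|.
Proof.
move=> dXY; rewrite -cardsX card_in_imset // => -[u v] [u' v'] /=.
rewrite !inE /= => /andP [uX vY] /andP [uX' vY'] E.
by have [-> ->] := cross_inj dXY dXY uX vY uX' vY' E.
Qed.

Lemma cross_pairs X Y : [disjoint X & Y] -> cross X Y \subset pairs n.
Proof.
move=> dXY; apply/subsetP => e /imsetP [[u v]] /=; rewrite inE /=.
case/andP=> uX vY ->; rewrite inE cards2.
suff -> : u != v by [].
by apply/eqP => uv; rewrite uv in uX; rewrite (disjointFr dXY uX) in vY.
Qed.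

Lemma cross_disjoint X Y X' Y' : [disjoint X & Y'] -> [disjoint X' & Y] ->
  [disjoint X & X'] || [disjoint Y & Y'] -> [disjoint cross X Y & cross X' Y'].
Proof.
move=> d1 d2 H; rewrite -setI_eq0; apply/eqP/setP => e; rewrite [RHS]inE inE.
apply/negP => /andP [/imsetP [[u v] /=]]; rewrite inE /= => /andP [uX vY] ->.
case/imsetP=> [[u' v'] /=]; rewrite inE /= => /andP [uX' vY'] E.
have [uE vE] := cross_inj d1 d2 uX vY uX' vY' E; subst u' v'.
case/orP: H => d; first by rewrite (disjointFr d uX) in uX'.
by rewrite (disjointFr d vY) in vY'.
Qed.

Lemma touching_cross E X Y : [disjoint X & Y] ->
  ~~ [disjoint cross X Y & E] -> touching E X Y.
Proof.
move=> dXY /pred0Pn [e /= /andP [/imsetP [[u v] /=]]]; rewrite inE /=.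
case/andP=> uX vY -> eE; apply/touchingP; exists u, v; split=> //.
rewrite /adj eE andbT; apply/eqP => uv; rewrite uv in uX.
by rewrite (disjointFr dXY uX) in vY.
Qed.

Section Layout.
Variables (k Rn L : nat) (sz m : nat -> nat) (s : seq 'I_n).
Hypothesis us : uniq s.
Hypothesis fit : k * L + \sum_(r < Rn) m r * sz r <= size s.

(** Layout along the path: the [k] hubs come first, then the pieces of round 0, of round 1, and so
    on. *)
Definition hub (i : 'I_k) := block s (i * L) L.

Definition offset r := k * L + \sum_(r' < r) m r' * sz r'.

Definition piece (x : nat * nat) := block s (offset x.1 + x.2 * sz x.1) (sz x.1).

Definition valid_piece : pred (nat * nat) := fun x => (x.1 < Rn) && (x.2 < m x.1).

Lemma offset_le r r' : r < r' -> offset r + m r * sz r <= offset r'.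
Proof.
elim: r' => // r' IH; rewrite ltnS leq_eqVlt /offset => /orP [/eqP ->|rr'].
  by rewrite big_ord_recr /= addnA.
by apply: leq_trans (IH rr') _; rewrite /offset big_ord_recr /= addnA leq_addr.
Qed.

Lemma hub_fit i : i < k -> i * L + L <= k * L.
Proof. by move=> ik; rewrite -mulSnr leq_mul2r ik orbT. Qed.

Lemma piece_fit q r : q < m r -> q * sz r + sz r <= m r * sz r.
Proof. by move=> qm; rewrite -mulSnr leq_mul2r qm orbT. Qed.

Lemma piece_end x : valid_piece x ->
  offset x.1 + x.2 * sz x.1 + sz x.1 <= size s.
Proof.
case/andP=> r q; apply: leq_trans fit; rewrite -/(offset Rn).
apply: leq_trans (offset_le r); rewrite -addnA leq_add2l; exact: piece_fit.
Qed.

Lemma hub_end i : i < k -> i * L + L <= size s.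
Proof.
move=> ik; apply: leq_trans fit; apply: leq_trans (leq_addr _ _).
exact: hub_fit.
Qed.

Lemma hub_disjoint (i j : 'I_k) : i != j -> [disjoint hub i & hub j].
Proof.
rewrite neq_ltn => ij; apply: block_disjoint => //.
by rewrite -!mulSnr !leq_mul2r; case/orP: ij => ->; rewrite ?orbT.
Qed.

Lemma hub_piece_disjoint (i : 'I_k) x : [disjoint hub i & piece x].
Proof.
apply: block_disjoint => //; apply/orP; left.
apply: leq_trans (hub_fit (ltn_ord i)) _.
by rewrite /offset -addnA leq_addr.
Qed.

Lemma piece_disjoint x y : valid_piece x -> valid_piece y -> x != y ->
  [disjoint piece x & piece y].
Proof.
case: x y => [r q] [r' q'] /andP [/= rR qm] /andP [/= rR' qm'] ne.
apply: block_disjoint => //=; case: (ltngtP r r') => rr'.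
- apply/orP; left; apply: leq_trans (leq_addr _ _).
  apply: leq_trans (offset_le rr'); rewrite -addnA leq_add2l; exact: piece_fit.
- apply/orP; right; apply: leq_trans (leq_addr _ _).
  apply: leq_trans (offset_le rr'); rewrite -addnA leq_add2l; exact: piece_fit.
- subst r'; have : q != q' by apply: contraNneq ne => ->.
  rewrite neq_ltn -!addnA -!mulSnr !leq_add2l !leq_mul2r.
  by case/orP=> ->; rewrite ?orbT.
Qed.

Definition hub_piece_edges r (q : 'I_(m r)) (i : 'I_k) :=
  cross (piece (r, val q)) (hub i).

Lemma card_hub_piece_edges r q i : r < Rn ->
  #|@hub_piece_edges r q i| = sz r * L.
Proof.
move=> rR; rewrite card_cross; last by rewrite disjoint_sym hub_piece_disjoint.
rewrite !card_block //; first exact: (hub_end (ltn_ord i)).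
by apply: (@piece_end (r, val q)); rewrite /valid_piece /= rR ltn_ord.
Qed.

Lemma hub_piece_edges_sub r q i : @hub_piece_edges r q i \subset pairs n.
Proof. by apply: cross_pairs; rewrite disjoint_sym hub_piece_disjoint. Qed.

Lemma hub_piece_edges_disjoint r q i q' i' : r < Rn -> (q, i) != (q', i') ->
  [disjoint @hub_piece_edges r q i & @hub_piece_edges r q' i'].
Proof.
move=> rR ne; apply: cross_disjoint; rewrite 1?disjoint_sym ?hub_piece_disjoint //.
case: (eqVneq q q') => [qq'|qq'].
  subst q'; apply/orP; right; rewrite disjoint_sym; apply: hub_disjoint.
  by apply: contraNneq ne => ->.
apply/orP; left; apply: piece_disjoint; rewrite /valid_piece /= ?rR ?ltn_ord //.
by apply/eqP => -[] /val_inj qE; rewrite qE eqxx in qq'.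
Qed.

(** [E1] makes hubs and pieces connected, [E2] supplies the links. With [b Rn = 1] no pair of
    surviving hubs is left unlinked, and at least half of the hubs survive. *)
Lemma sprinkled_minor (b d h : nat -> nat) E1 E2 :
  sorted (adj E1) s -> 0 < L -> (forall r, 0 < sz r) ->
  k * k <= b 0 -> 0 < k -> b Rn = 1 ->
  (forall r, r < Rn -> 2 * b r <= h r * d r /\ 0 < d r) ->
  (forall r, r < Rn -> expanding (@hub_piece_edges r) E2 (b r.+1) (d r) (b r)) ->
  2 * \sum_(r < Rn) h r <= k ->
  exists k', k <= 2 * k' /\ has_K_minor (E1 :|: E2) k'.
Proof.
move=> ss L0 sz0 kb k0 bR Hd Hexp hk.
pose con r q i := ~~ [disjoint cross (piece (r, q)) (hub i) & E2].
have Hcon r : r < Rn -> has_connectors (con r) (m r) (b r.+1) (d r) (b r).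
  move=> rR J Q Jb Jd Jo Qb.
  move/forallP/(_ J)/forallP/(_ Q): (Hexp r rR).
  rewrite Jb eqxx Jd Qb -/(ordered J) Jo /= => /existsP [q /andP [qQ]].
  by case/exists_inP=> e eJ H; exists q, e.
have [A [J [g [JA Jb gP ginj kA]]]] := rounds Hcon Hd kb k0.
have {}J0 : J = set0.
  by apply/eqP; rewrite -cards_eq0; move: Jb; rewrite bR; case: #|J|.
rewrite J0 setD0 in gP ginj.
exists #|A|; split; first by move: kA hk; move: #|A| => a; lia.
apply: (@has_K_minor_links n _ k hub piece valid_piece A g) => //.
- move=> i; apply: connected_inS (subsetUl _ _) _.
  by apply: block_connected => //; apply: hub_end.
- move=> x vx; apply: connected_inS (subsetUl _ _) _.
  by apply: block_connected => //; apply: piece_end.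
- exact: hub_disjoint.
- exact: piece_disjoint.
- by move=> i x _; apply: hub_piece_disjoint.
- move=> e eA; have [gR gm /andP [c1 c2]] := gP e eA.
  have tc i : con (g e).1 (g e).2 i -> touching (E1 :|: E2) (piece (g e)) (hub i).
    move=> c; apply: touchingS (subsetUr E1 E2) (subxx _) (subxx _) _.
    apply: touching_cross; first by rewrite disjoint_sym hub_piece_disjoint.
    by move: c; rewrite /con -surjective_pairing.
  by split; [apply/andP | apply: tc | apply: tc].
Qed.

End Layout.
End Blocks.

Local Open Scope ring_scope.

(** * Estimates *)

Local Notation R := Rdefinitions.R.
Local Notation exp := Rtrigo_def.exp.

Lemma exp_ge1D (x : R) : 1 + x <= exp x.
Proof. by apply/RleP; apply: Rpower.exp_ineq1_le. Qed.

Lemma exp_gt0 (x : R) : 0 < exp x.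
Proof. by apply/RltP; apply: Exp_prop.exp_pos. Qed.

Lemma exp_le (x y : R) : x <= y -> exp x <= exp y.
Proof.
move=> xy; rewrite -[y](subrK x) addrC -Rstruct.expRD -[leLHS]mulr1.
apply: ler_wpM2l; first exact/ltW/exp_gt0.
by apply: le_trans (exp_ge1D _); rewrite lerDl subr_ge0.
Qed.

Lemma exp_ge_sqr (x : R) : 0 <= x -> x ^+ 2 / 4 <= exp x.
Proof.
move=> x0; have H := exp_ge1D (x / 2).
have -> : exp x = exp (x / 2) ^+ 2 by rewrite Rstruct.expRX; congr exp; rewrite mulr2n; lra.
have : 0 <= 1 + x / 2 by lra.
move: H; move: (exp _) => e He H; nra.
Qed.

Lemma pow2_le_exp (n : nat) : 2 ^+ n <= exp (n%:R : R).
Proof.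
have -> : exp n%:R = exp 1 ^+ n by rewrite Rstruct.expRX.
apply: lerXn2r; rewrite ?nnegrE ?(ltW (exp_gt0 _)) //.
by have := exp_ge1D 1.
Qed.

Lemma bernoulli (x : R) n : -1 <= x -> 1 + n%:R * x <= (1 + x) ^+ n.
Proof.
move=> x1; elim: n => [|n IH]; first by rewrite mul0r addr0 expr0.
rewrite exprS; apply: le_trans (_ : (1 + x) * (1 + n%:R * x) <= _).
  rewrite -natr1; have : 0 <= (n%:R : R) * (x * x).
    by rewrite mulr_ge0 // -expr2 sqr_ge0.
  by move: (n%:R : R) => c; lra.
by apply: ler_wpM2l => //; lra.
Qed.

Lemma pow1B_le_exp (x : R) n : 0 <= x <= 1 -> (1 - x) ^+ n <= exp (- (n%:R * x)).
Proof.
move=> x01; have -> : exp (- (n%:R * x)) = exp (- x) ^+ n.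
  by rewrite Rstruct.expRX; congr exp; rewrite mulNrn mulr_natl.
apply: lerXn2r; rewrite ?nnegrE ?(ltW (exp_gt0 _)) //; first by lra.
by have := exp_ge1D (- x).
Qed.

Lemma exp1_le3 : exp 1 <= 3 :> R.
Proof.
by have /RleP := Rpower.exp_le_3; rewrite Rstruct.IZRposE Rstruct.INRE.
Qed.

Lemma nat_above (x : R) : exists n : nat, x <= n%:R.
Proof.
exists (Num.bound `|x|); apply: le_trans (ler_norm _) (ltW _).
exact: archi_boundP.
Qed.

Lemma expr_unbounded (B : R) (C : R) : 1 < B -> exists K : nat, C <= B ^+ K.
Proof.
move=> B1; have B0 : 0 < B - 1 by lra.
have [K HK] := nat_above (C / (B - 1)); exists K.
have H : 1 + K%:R * (B - 1) <= (1 + (B - 1)) ^+ K by apply: bernoulli; lra.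
rewrite (addrC 1 (B - 1)) subrK in H; apply: le_trans H.
by rewrite ler_pdivrMr // in HK; lra.
Qed.

(** The search bound is applied with [alpha = 1 - th] and [x = K * y]. Each finished vertex
    contributes at least [B > 1] to the weight, and [K] of them outweigh the loss [1 - th] of one
    stack vertex, which leaves at least [2 ^ y]. *)
Lemma expect_no_long_path (c1 : R) : 1 < c1 ->
  exists (gam : R) (n0 : nat), 0 < gam /\ forall (n : nat) (p : R),
    (n0 <= n)%N -> 0 <= p <= 2^-1 -> c1 <= p * n%:R ->
    exists y : nat, gam * n%:R <= y%:R /\
      expect (pairs n) p (fun E => (~~ has_path E y)%:R) * (gam * n%:R) <= 1.
Proof.
move=> c1_gt1.
pose c' : R := (1 + c1) / 2.
have c'1 : 1 < c' by rewrite /c'; lra.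
(* In [B = 1 + th * (c' - 1) - th^2 * c'] this value makes the loss exactly half of the gain. *)
pose th : R := (c' - 1) / (2 * c').
have thE : th * c' = (c' - 1) / 2 by rewrite /th; field; lra.
have th0 : 0 < th by rewrite /th divr_gt0 //; lra.
have th1 : th < 1 by rewrite /th ltr_pdivrMr; lra.
pose B := (1 - th) * (1 + th * c').
have B1 : 1 < B by rewrite /B thE; nra.
have [K HK] := expr_unbounded (2 / (1 - th)) B1.
have HK2 : 2 <= (1 - th) * B ^+ K.
  by rewrite mulrC -ler_pdivrMr //; lra.
(* The [(K + 1) * y <= eta * n] finished and stack vertices leave [g >= (c' / c1) * n] others, so
   that [p * g >= c']. *)
pose eta : R := 1 - c' / c1.
have eta0 : 0 < eta by rewrite subr_gt0 ltr_pdivrMr; rewrite /c'; lra.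
pose gam := eta / K.+1%:R / 2.
have K0 : 0 < K.+1%:R :> R by rewrite ltr0n.
have gam0 : 0 < gam by rewrite !divr_gt0.
have [n0 Hn0] := nat_above gam^-1.
exists gam, n0; split => // n p nn0 p01 pn.
have n_big : gam^-1 <= n%:R by apply: le_trans Hn0 _; rewrite ler_nat.
have gn1 : 1 <= gam * n%:R by rewrite mulrC -ler_pdivrMr // mul1r.
have [y y_itv] : exists y : nat, y%:R <= 2 * gam * n%:R < y.+1%:R.
  by exists (Num.truncn (2 * gam * n%:R)); apply: truncn_itv; lra.
exists y.
have y_ge : gam * n%:R <= y%:R by move: y_itv; rewrite -natr1; lra.
split => //.
pose x := (K * y)%N; pose g := (n - x - y)%N.
have Ky : (K.+1 * y)%:R <= eta * n%:R.
  rewrite natrM mulrC -ler_pdivlMr //; case/andP: y_itv => H _.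
  apply: le_trans H _; rewrite le_eqVlt; apply/orP; left; apply/eqP.
  by rewrite /gam; field; rewrite addrC natr1 lt0r_neq0.
have eta1 : eta < 1 by rewrite /eta gtrBl divr_gt0 //; lra.
have xyn : (x + y <= n)%N.
  rewrite -(ler_nat R) /x addnC -mulSn; apply: le_trans Ky _.
  by rewrite ger_pMl ?ltW // ltr0n; case: (n) pn => //; rewrite mulr0; lra.
have xn : (x <= n)%N by apply: leq_trans xyn; apply: leq_addr.
have gE : (g%:R : R) = n%:R - (K.+1 * y)%:R.
  by rewrite /g -subnDA natrB // mulSn addnC.
have pg : c' <= p * g%:R.
  have n_ge0 : 0 <= n%:R :> R by [].
  have : (1 - eta) * n%:R <= g%:R by rewrite gE; lra.
  have -> : 1 - eta = c' / c1 by rewrite /eta; lra.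
  move=> H; have p0 : 0 <= p by case/andP: p01.
  have := ler_wpM2l p0 H; have -> : p * (c' / c1 * n%:R) = (c' / c1) * (p * n%:R) by ring.
  apply: le_trans; rewrite -ler_pdivrMl; last by rewrite divr_gt0; lra.
  by rewrite invf_div divfK //; lra.
pose beta : R := 1 + th * p / (1 - p).
have p1 : 0 < 1 - p by lra.
have thp : 0 <= th * p by apply: mulr_ge0; lra.
have beta_ge : 1 + th * p <= beta.
  by rewrite /beta lerD2l ler_pdivlMr // ler_piMr //; lra.
have mean : p * (1 - th) + (1 - p) * beta = 1.
  by rewrite /beta; field; lra.
have beta1 : 1 <= beta by lra.
have := @expect_no_path n x y R p (1 - th) beta mean.
move=> /(_ _ _ beta1 xn) H.
have {}H : expect (pairs n) p (fun E => (~~ has_path E y)%:R) *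
   ((1 - th) ^+ (x + y) * beta ^+ (x * g)) <= 1 by apply: H; lra.
apply: le_trans H; apply: ler_wpM2l.
  by apply: expect_ge0 => //; lra.
have yle2 : (y%:R : R) <= 2 ^+ y by rewrite -natrX ler_nat ltnW // ltn_expl.
case/andP: (y_itv) => _ y_lt.
have gy : gam * n%:R <= 2 ^+ y by apply: le_trans yle2.
apply: le_trans gy _.
have Bg : B <= (1 - th) * beta ^+ g.
  rewrite /B; apply: ler_wpM2l; first by rewrite subr_ge0 ltW.
  apply: le_trans (_ : (1 + th * p) ^+ g <= _); last by apply: lerXn2r; rewrite ?nnegrE //; lra.
  apply: le_trans (bernoulli g _); last by lra.
  by rewrite lerD2l [leRHS]mulrCA ler_pM2l // [leRHS]mulrC.
have -> : (1 - th) ^+ (x + y) * beta ^+ (x * g) =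
   ((1 - th) * ((1 - th) * beta ^+ g) ^+ K) ^+ y.
  rewrite exprMn [in RHS]exprMn exprMn -!exprM exprD /x.
  by rewrite (mulnC g) [RHS]mulrCA mulrA.
apply: lerXn2r; rewrite ?nnegrE //.
  apply: mulr_ge0; first by lra.
  by apply: exprn_ge0; apply: le_trans Bg; lra.
apply: le_trans HK2 _; apply: ler_wpM2l; first by lra.
by apply: lerXn2r; rewrite ?nnegrE //; [lra | apply: le_trans Bg; lra].
Qed.

(** This is [card_small_sets] at [y = 1 / N], where [(1 + 1 / N)^(N t) <= e^t]. *)
Lemma card_small_sets_exp (X : finType) (t N : nat) : (0 < N)%N -> #|X| = (N * t)%N ->
  #|[set J : {set X} | (#|J| <= t)%N]|%:R <= (N%:R * exp 1) ^+ t :> R.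
Proof.
move=> N0 XN; have N0' : 0 < N%:R :> R by rewrite ltr0n.
have Ni : 0 <= (N%:R : R)^-1 <= 1 by rewrite invr_ge0 ltW //= invf_le1 // ler1n.
have := card_small_sets X t Ni; rewrite XN => H.
have : (1 + (N%:R : R)^-1) ^+ (N * t) <= exp 1 ^+ t.
  rewrite exprM; apply: lerXn2r; rewrite ?nnegrE ?exprn_ge0 ?(ltW (exp_gt0 _)) //.
    by rewrite addr_ge0 //; case/andP: Ni.
  have -> : exp 1 = exp (N%:R^-1) ^+ N.
    by rewrite Rstruct.expRX; congr exp; rewrite -[RHS]mulr_natr mulVf // gt_eqF.
  apply: lerXn2r; rewrite ?nnegrE ?(ltW (exp_gt0 _)) ?exp_ge1D //.
  by rewrite addr_ge0 //; case/andP: Ni.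
move=> H2; have := le_trans H H2; rewrite exprVn ler_pdivrMr ?exprn_gt0 //.
by rewrite exprMn mulrC.
Qed.

(** The lower bound comes from [(1 - p)^M (1 + p)^M <= 1] and from [1 - 1 / (1 + x) >= x / 2] for
    [0 <= x <= 1]. *)
Lemma rho_bounds (p : R) M : 0 <= p <= 1 -> M%:R * p <= 1 ->
  M%:R * p / 2 <= rho p M <= M%:R * p.
Proof.
move=> p01 Mp; set x := M%:R * p; have x0 : 0 <= x by apply: mulr_ge0 => //; lra.
rewrite /rho; apply/andP; split; last first.
  have := @bernoulli (- p) M; rewrite mulrN -/x => H.
  by have := H (_ : -1 <= - p); lra.
have H1 : 1 + x <= (1 + p) ^+ M by apply: bernoulli; lra.
have H2 : (1 - p) ^+ M * (1 + p) ^+ M <= 1.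
  by rewrite -exprMn; apply: exprn_ile1; nra.
have H0 : 0 <= (1 - p) ^+ M by apply: exprn_ge0; lra.
have H3 : (1 - p) ^+ M * (1 + x) <= 1 by apply: le_trans H2; apply: ler_wpM2l.
rewrite -/x in Mp; move: H0 H3; move: (_ ^+ _) => z H0 H3; nra.
Qed.

(** * Failure probability of one round of linking *)

Section Round.
Variables (T : finType) (U : {set T}) (n Rn r a s : nat) (eps : R).
Local Notation sz := (s * 4 ^ r)%N.
Local Notation m := (s * (2 ^ r * 16 ^ (Rn - r)))%N.
Local Notation L := (a * s * 4 ^ Rn)%N.
Variable D : 'I_m -> 'I_(4 ^ Rn) -> {set T}.
Hypothesis D_sub : forall q i, D q i \subset U.
Hypothesis D_disj : forall q i q' i', (q, i) != (q', i') ->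
  [disjoint D q i & D q' i'].
Hypothesis D_card : forall q i, #|D q i| = (sz * L)%N.
Hypotheses (rR : (r < Rn)%N) (s2 : (2 <= s)%N) (a0 : (0 < a)%N).
Hypotheses (eps0 : 0 < eps) (aeps : 32 * eps <= a%:R) (epsn : eps <= n%:R).
Hypothesis n_lo : ((a * s) ^ 2 * 16 ^ Rn <= n)%N.
Hypothesis n_hi : (n <= 16 * ((a * s) ^ 2 * 16 ^ Rn))%N.

(** Lower bound for the chance that a connector links one of [16^(Rn-r-1)] pairs, equal to
    [(eps / (128 a))^2 / 2]. In 128, a factor 16 is the uncertainty of [n], 4 the ratio of
    [4^(Rn-r)] to [4^(Rn-r-1)], and 2 the loss in [rho_bounds]. *)
Definition omega : R := (eps / (32 * a%:R)) ^+ 2 / 32.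

Hypothesis s_big : 16 * exp 1 ^+ 2 * s%:R * 32 ^+ r <=
  exp ((omega * s%:R / 2 - 1) * 2 ^+ r).

Lemma expect_round_fails :
  expect U (eps / n%:R) (fun E => (~~ expanding D E (16 ^ (Rn - r.+1))
     (8 * 4 ^ (Rn - r)) (16 ^ (Rn - r)))%:R) <= exp (- (2 ^ r * 16 ^ (Rn - r))%:R).
Proof.
pose v := (4 ^ (Rn - r.+1))%N.
have v0 : (0 < v)%N by rewrite expn_gt0.
have RrS : (Rn - r = (Rn - r.+1).+1)%N by rewrite subnSK.
have w_v : (4 ^ (Rn - r) = 4 * v)%N by rewrite RrS expnS.
have b'E : (16 ^ (Rn - r.+1) = v ^ 2)%N by rewrite /v -expnM mulnC expnM.
have tE : (16 ^ (Rn - r) = 16 * v ^ 2)%N by rewrite RrS expnS b'E.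
have kE : (4 ^ Rn = 4 ^ r * (4 * v))%N by rewrite -w_v -expnD subnKC // ltnW.
have kkE : (16 ^ Rn = (4 ^ r * (4 * v)) ^ 2)%N by rewrite -kE -expnM mulnC expnM.
have n0 : 0 < n%:R :> R by apply: lt_le_trans epsn.
have a0' : 0 < a%:R :> R by rewrite ltr0n.
have s0' : 0 < s%:R :> R by rewrite ltr0n; apply: leq_trans s2.
have v0' : 0 < v%:R :> R by rewrite ltr0n.
have f0 : 0 < 4 ^+ r :> R by rewrite exprn_gt0.
set p := eps / n%:R.
have p01 : 0 <= p <= 1.
  apply/andP; split; first by rewrite /p divr_ge0 // ltW.
  by rewrite /p ler_pdivrMr // mul1r.
pose x := (sz * L)%:R * p.
have xE : x = eps * (s%:R ^+ 2 * a%:R * (4 ^+ r) ^+ 2 * (4 * v%:R)) / n%:R.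
  rewrite /x /p kE !natrM !natrX; ring.
have n_lo' : (a%:R * s%:R * (4 ^+ r * (4 * v%:R))) ^+ 2 <= n%:R :> R.
  have := n_lo; rewrite kkE -(ler_nat R) -expnMn natrX !natrM natrX; exact.
have n_hi' : n%:R <= 16 * (a%:R * s%:R * (4 ^+ r * (4 * v%:R))) ^+ 2 :> R.
  have := n_hi; rewrite kkE -(ler_nat R) -expnMn natrM natrX !natrM natrX; exact.
have x_hi : x <= eps / a%:R / (4 * v%:R).
  rewrite xE ler_pdivrMr //.
  apply: le_trans (_ : eps / a%:R / (4 * v%:R) * (a%:R * s%:R * (4 ^+ r * (4 * v%:R))) ^+ 2 <= _).
    rewrite le_eqVlt; apply/orP; left; apply/eqP; field.
    by rewrite !gt_eqF.
  by apply: ler_wpM2l => //; rewrite !divr_ge0 ?mulr_ge0 ?ltW.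
have x_lo : eps / a%:R / (4 * v%:R) / 16 <= x.
  rewrite xE ler_pdivlMr //.
  apply: le_trans (_ : eps / a%:R / (4 * v%:R) / 16 * (16 * (a%:R * s%:R * (4 ^+ r * (4 * v%:R))) ^+ 2) <= _).
    by apply: ler_wpM2l => //; rewrite !divr_ge0 ?mulr_ge0 ?ltW.
  rewrite le_eqVlt; apply/orP; left; apply/eqP; field.
  by rewrite !gt_eqF.
pose z := eps / a%:R.
have z0 : 0 < z by rewrite divr_gt0.
have z32 : 32 * z <= 1 by rewrite /z mulrA ler_pdivrMr // mul1r.
have v1 : 1 <= v%:R :> R by rewrite ler1n.
have vi1 : (v%:R : R)^-1 <= 1 by rewrite invf_le1.
have vi0 : 0 < (v%:R : R)^-1 by rewrite invr_gt0.
have vvi : v%:R * v%:R^-1 = 1 :> R by rewrite divff // gt_eqF.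
pose c := (v%:R : R)^-1.
have zv : eps / a%:R / (4 * v%:R) = z * c / 4 by rewrite invfM /z /c; ring.
rewrite zv in x_hi x_lo.
have zc1 : z * c <= z by rewrite ger_pMr.
have x1 : x <= 1 by lra.
have /andP [rho_lo rho_hi] := rho_bounds p01 x1.
set rh := rho p _ in rho_lo rho_hi; rewrite -/x in rho_lo rho_hi.
have rh_hi : rh <= z * c / 4 by apply: le_trans x_hi.
have rh_lo : z * c / 128 <= rh by lra.
have zc0 : 0 < z * c by rewrite mulr_gt0.
have vrh_hi : v%:R * rh <= z / 4.
  apply: le_trans (_ : v%:R * (z * c / 4) <= _); first by rewrite ler_pM2l.
  have -> : v%:R * (z * c / 4) = (v%:R * c) * (z / 4) by ring.
  by rewrite /c vvi mul1r.
have vrh_lo : z / 128 <= v%:R * rh.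
  apply: le_trans (_ : _ <= v%:R * (z * c / 128)) _; last by rewrite ler_pM2l.
  have -> : v%:R * (z * c / 128) = (v%:R * c) * (z / 128) by ring.
  by rewrite /c vvi mul1r.
(* From [32 * z <= 1]: the left side is [32 * (v * rh) <= 8 * z <= 1 / 4]. *)
have dr : (8 * 4 ^ (Rn - r))%:R * rh <= 4^-1.
  rewrite w_v !natrM; have -> : 8 * (4 * v%:R) * rh = 32 * (v%:R * rh) by ring.
  by lra.
have b2 : (16 ^ (Rn - r.+1))%:R * rh ^+ 2 = (v%:R * rh) ^+ 2 :> R.
  by rewrite b'E natrX exprMn.
have vrh0 : 0 <= v%:R * rh by apply: le_trans vrh_lo; lra.
have br : (16 ^ (Rn - r.+1))%:R * rh ^+ 2 <= 2^-1.
  by rewrite b2; move: vrh0 vrh_hi z32; move: (_ * rh) => g; nra.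
have om : omega <= (16 ^ (Rn - r.+1))%:R * rh ^+ 2 / 2.
  rewrite b2 /omega; have -> : eps / (32 * a%:R) = z / 32 by rewrite /z invfM; ring.
  have : (z / 128) ^+ 2 <= (v%:R * rh) ^+ 2 by apply: lerXn2r; rewrite ?nnegrE //; lra.
  by rewrite !exprMn; lra.
have om0 : 0 < omega by rewrite /omega divr_gt0 // exprn_gt0 // divr_gt0 // mulr_gt0.
have := expect_not_expanding p01 D_sub D_disj D_card (16 ^ (Rn - r)) dr br.
rewrite -/rh => H; apply: le_trans H _.
pose w2 := (16 ^ (Rn - r))%N.
pose e1 : R := (16 ^ r.+1)%:R * exp 1; pose e2 : R := (s * 2 ^ r)%:R * exp 1.
have e1_1 : 1 <= e1.
  rewrite /e1 -[leLHS]mulr1; apply: ler_pM => //; first by rewrite ler1n expn_gt0.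
  by have := exp_ge1D 1; lra.
(* The exponent grows from [16^(Rn-r-1)] to [w2] so that all factors share it; [1 <= e1] permits
   this. *)
have cJ : #|[set J : {set 'I_(4 ^ Rn) * 'I_(4 ^ Rn)} | (#|J| <= 16 ^ (Rn - r.+1))%N]|%:R
    <= e1 ^+ w2.
  apply: le_trans (card_small_sets_exp (N := 16 ^ r.+1) _ _) _.
  - by rewrite expn_gt0.
  - by rewrite card_prod card_ord -expnMn -expnD subnKC.
  - by rewrite -/e1; apply: ler_weXn2l => //; rewrite leq_exp2l // leq_sub2l.
have cQ : #|[set Q : {set 'I_m} | (#|Q| <= w2)%N]|%:R <= e2 ^+ w2.
  apply: card_small_sets_exp; first by rewrite muln_gt0 expn_gt0 andbT; apply: leq_trans s2.
  by rewrite card_ord mulnA.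
(* As [s >= 2], at most half of the connectors are spent. *)
have mw : (s%:R * 2 ^+ r * w2%:R / 2 <= (m - w2)%:R :> R).
  have h : (2 * w2 <= m)%N.
    by rewrite mulnA leq_mul2r; apply/orP; right; apply: leq_trans s2 (leq_pmulr _ _); rewrite expn_gt0.
  have : (w2 <= m)%N by apply: leq_trans h; rewrite leq_pmull.
  move=> h2; rewrite natrB // -[m]/(s * (2 ^ r * w2))%N !natrM natrX.
  by move: h; rewrite -(ler_nat R) -[m]/(s * (2 ^ r * w2))%N !natrM natrX; lra.
have last_le : (1 - (16 ^ (Rn - r.+1))%:R * rh ^+ 2 / 2) ^+ (m - w2) <=
    exp (- (omega * s%:R / 2 * 2 ^+ r)) ^+ w2.
  apply: le_trans (pow1B_le_exp _ _) _.
    by apply/andP; split; lra.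
  rewrite Rstruct.expRX; apply: exp_le; rewrite mulNrn lerN2 -[_ *+ w2]mulr_natr.
  apply: le_trans (_ : (m - w2)%:R * omega <= _); last first.
    by apply: ler_wpM2l.
  have := ler_wpM2r (ltW om0) mw; apply: le_trans.
  by rewrite le_eqVlt; apply/orP; left; apply/eqP; field.
have q0 : 0 <= 1 - (16 ^ (Rn - r.+1))%:R * rh ^+ 2 / 2 by lra.
apply: le_trans (_ : e1 ^+ w2 * e2 ^+ w2 * exp (- (omega * s%:R / 2 * 2 ^+ r)) ^+ w2 <= _).
  apply: ler_pM => //; first by rewrite mulr_ge0.
    by apply: exprn_ge0.
  by apply: ler_pM.
have -> : exp (- (2 ^ r * 16 ^ (Rn - r))%:R) = exp (- 2 ^+ r) ^+ w2.
  by rewrite Rstruct.expRX; congr exp; rewrite natrM natrX mulNrn mulr_natr.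
rewrite -!exprMn; apply: lerXn2r; rewrite ?nnegrE ?(ltW (exp_gt0 _)) //.
  apply: mulr_ge0; last exact/ltW/exp_gt0.
  by rewrite mulr_ge0 // mulr_ge0 // ltW // exp_gt0.
have E12 : e1 * e2 = 16 * exp 1 ^+ 2 * s%:R * 32 ^+ r.
  rewrite /e1 /e2 expnS !natrM !natrX (_ : 32 = 16 * 2 :> R); last by ring.
  by rewrite exprMn; ring.
rewrite E12; apply: le_trans (ler_wpM2r (ltW (exp_gt0 _)) s_big) _.
by rewrite Rstruct.expRD Rstruct.RplusE; apply: exp_le; rewrite le_eqVlt; apply/orP; left; apply/eqP; ring.
Qed.

End Round.

(** * Number of edges and the upper bound *)

Lemma expect_exp_card (n : nat) (p : R) :
  expect (pairs n) p (fun E => exp 2^-1 ^+ #|E|) =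
  (1 + (exp 2^-1 - 1) * p) ^+ #|pairs n|.
Proof.
transitivity (expect (pairs n) p (fun E =>
   \prod_(e in pairs n) (if e \in E then exp 2^-1 else 1))).
  apply: eq_expect => E EU; rewrite -big_mkcondr /= -prodr_const.
  apply: eq_bigl => e; case: (boolP (e \in E)) => eE; rewrite ?andbF //.
  by rewrite (subsetP EU).
rewrite (@expect_prod _ _ _ _ _ _ (fun e => [set e])).
- rewrite -prodr_const; apply: eq_bigr => e eU.
  rewrite (expect_avg _ _ eU) -[RHS](expect_cst (pairs n) p).
  by apply: eq_expect => E _; rewrite /avg !inE eqxx /=; ring.
- by move=> e _ E E' /setP/(_ e); rewrite !inE eqxx !andbT => ->.
- by move=> i j _ _ ij; rewrite disjoints1 inE.
Qed.

Lemma card_pairs (n : nat) : (2 * #|pairs n| = n * n.-1)%N.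
Proof.
have -> : #|pairs n| = 'C(n, 2) by rewrite -[n in RHS]card_ord -card_draws.
by rewrite -mul_bin_diag bin1.
Qed.

(* Markov's inequality for exp(|E|/2), of mean at most
   exp((sqrt e - 1) c n / 2), where (sqrt e - 1) / 2 < 1 / 2. *)
Lemma expect_many_edges (c : R) (n : nat) : 1 < c -> c <= n%:R ->
  expect (pairs n) (c / n%:R) (fun E => (c * n%:R < #|E|%:R)%R%:R)
    <= 8 / (c * n%:R).
Proof.
move=> c1 cn; have n0 : 0 < n%:R :> R by lra.
set p := c / n%:R; pose q := exp 2^-1.
have p0 : 0 <= p by rewrite divr_ge0 //; lra.
have p01 : 0 <= p <= 1 by rewrite p0 ler_pdivrMr // mul1r.
have q1 : 1 <= q by apply: le_trans (exp_ge1D _); lra.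
(* Here [q ^ 2 = e <= 3 < (7 / 4) ^ 2], so the final exponent is [(3 / 8 - 1 / 2) * c * n], and
   [exp (- x) <= 1 / x] gives the constant 8. *)
have q2 : q <= 7 / 4.
  have : q ^+ 2 <= 3.
    by rewrite /q Rstruct.expRX -[_ *+ 2]mulr_natr mulVf ?pnatr_eq0 // exp1_le3.
  by move: q1; move: q => z; nra.
have cn0 : 0 < c * n%:R by rewrite mulr_gt0 //; lra.
apply: le_trans (_ : expect (pairs n) p (fun E => exp (- (c * n%:R / 2)) * q ^+ #|E|) <= _).
  apply: ler_expect => // E _; case: ltP => /= [H|_]; last first.
    by rewrite mulr_ge0 ?exprn_ge0 ?(ltW (exp_gt0 _)).
  rewrite /q Rstruct.expRX Rstruct.expRD Rstruct.RplusE.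
  apply: le_trans (_ : 1 + (- (c * n%:R / 2) + 2^-1 *+ #|E|) <= _); last exact: exp_ge1D.
  by rewrite -[_^-1 *+ _]mulr_natr; move: H; move: (#|E|%:R : R) => e; lra.
rewrite expectZ expect_exp_card -/q.
have H : (1 + (q - 1) * p) ^+ #|pairs n| <= exp (3 / 8 * (c * n%:R)).
  apply: le_trans (_ : exp ((q - 1) * p) ^+ #|pairs n| <= _).
    apply: lerXn2r; rewrite ?nnegrE ?(ltW (exp_gt0 _)) ?exp_ge1D //.
    by rewrite addr_ge0 // mulr_ge0 //; lra.
  rewrite Rstruct.expRX; apply: exp_le; rewrite -[leLHS]mulr_natr -mulrA.
  have Mle : 2 * #|pairs n|%:R <= n%:R * n%:R :> R.
    by rewrite -!natrM ler_nat card_pairs leq_mul2l leq_pred orbT.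
  have pM : p * #|pairs n|%:R <= c * n%:R / 2.
    have -> : c * n%:R / 2 = p * (n%:R * n%:R / 2) by rewrite /p; field; rewrite gt_eqF.
    by apply: ler_wpM2l => //; lra.
  apply: le_trans (_ : 3 / 4 * (p * #|pairs n|%:R) <= _); last by lra.
  by apply: ler_wpM2r; [rewrite mulr_ge0 | lra].
apply: le_trans (ler_wpM2l (ltW (exp_gt0 _)) H) _.
rewrite Rstruct.expRD Rstruct.RplusE.
have -> : - (c * n%:R / 2) + 3 / 8 * (c * n%:R) = - (c * n%:R / 8) by field.
clear H.
have := exp_ge1D (c * n%:R / 8).
have : exp (c * n%:R / 8) * exp (- (c * n%:R / 8)) = 1.
  by rewrite Rstruct.expRD Rstruct.RplusE subrr Rstruct.expR0.
rewrite ler_pdivlMr //; have := exp_gt0 (- (c * n%:R / 8)).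
by move: (exp _) (exp _) => u w; nra.
Qed.

(** For [k >= 2], [k^2 <= 2 k (k - 1) <= 4 |E|]; smaller [k] are covered by [c * n >= 1]. *)
Lemma ccl_le_edges (c : R) (n : nat) (E : {set {set 'I_n}}) : 1 < c -> (0 < n)%N ->
  #|E|%:R <= c * n%:R -> (ccl E)%:R <= 2 * Num.sqrt (c * n%:R) :> R.
Proof.
move=> c1 n0 Ecn; have n1 : 1 <= n%:R :> R by rewrite ler1n.
have cn0 : 1 <= c * n%:R by nra.
have H := minor_edges (has_K_minor_ccl E).
move: (ccl E) H => k H.
rewrite -(ler_pXn2r (n := 2)) ?nnegrE ?mulr_ge0 ?sqrtr_ge0 //.
rewrite exprMn sqr_sqrtr; last by lra.
case: k H => [|[|k]] H.
- by rewrite expr0n /=; lra.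
- by rewrite expr1n; lra.
have : (k.+2%:R * k.+1%:R : R) <= 2 * #|E|%:R by rewrite -!natrM ler_nat.
have : (1 : R) <= k.+1%:R by rewrite ler1n.
have : (k.+2%:R : R) = k.+1%:R + 1 by rewrite natr1.
by move: (k.+2%:R : R) (k.+1%:R : R) => x y xE y1; rewrite xE; nra.
Qed.

(** With [tau = om * s / 2 - 1], a large [s] gives [16 e^2 s <= exp tau] and [32 <= exp tau]; then
    [r + 1 <= 2^r] makes the same [s] serve every round. *)
Lemma exists_scale (om : R) : 0 < om -> exists s : nat, (2 <= s)%N /\
  forall r : nat, 16 * exp 1 ^+ 2 * s%:R * 32 ^+ r <= exp ((om * s%:R / 2 - 1) * 2 ^+ r).
Proof.
move=> om0.
(* [96^2 = 64 * 16 * 9] is what comparing [(om s / 4)^2 / 4] with [16 * 9 * s] requires. *)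
have [s1 H1] := nat_above ((96 / om) ^+ 2); have [s2 H2] := nat_above (24 / om).
have [s [s_gt1 s_s1 s_s2]] : exists s, [/\ 1 < s, s1 <= s & s2 <= s]%N.
  by exists (s1 + s2).+2; clear; split; lia.
exists s; split=> // r.
have h1 : 96 ^+ 2 <= om ^+ 2 * s%:R.
  rewrite mulrC -ler_pdivrMr ?exprn_gt0 // -expr_div_n; apply: le_trans H1 _.
  by rewrite ler_nat.
have h2 : 24 <= om * s%:R.
  by rewrite mulrC -ler_pdivrMr //; apply: le_trans H2 _; rewrite ler_nat.
have s0 : 0 < s%:R :> R by rewrite ltr0n ltnW.
clear s1 s2 H1 H2 s_gt1 s_s1 s_s2.
pose tau := om * s%:R / 2 - 1.
have tau5 : 5 <= tau by rewrite /tau; lra.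
have tau4 : om * s%:R / 4 <= tau by rewrite /tau; lra.
have e32 : 32 <= exp tau.
  apply: le_trans (exp_le tau5); apply: le_trans (pow2_le_exp 5).
  by rewrite (_ : 32 = 2 ^+ 5 :> R) //; ring.
have es : 16 * exp 1 ^+ 2 * s%:R <= exp tau.
  apply: le_trans (exp_ge_sqr _); last by lra.
  apply: le_trans (_ : (om * s%:R / 4) ^+ 2 / 4 <= _).
    have e9 : exp 1 ^+ 2 <= 9 :> R.
      by have := exp1_le3; have := exp_gt0 1; move: (exp 1) => e; nra.
    apply: le_trans (_ : 16 * 9 * s%:R <= _).
      by rewrite ler_pM2r //; lra.
    have -> : (om * s%:R / 4) ^+ 2 / 4 = (om ^+ 2 * s%:R / 64) * s%:R by field.
    by rewrite ler_pM2r //; lra.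
  rewrite ler_pM2r ?invr_gt0 //; apply: lerXn2r; rewrite ?nnegrE //; last by lra.
  by lra.
rewrite -/tau; apply: le_trans (_ : exp tau * exp tau ^+ r <= _).
  apply: ler_pM => //; first last.
  - by apply: lerXn2r; rewrite ?nnegrE ?(ltW (exp_gt0 _)).
  - by rewrite exprn_ge0.
  by rewrite !mulr_ge0 ?exprn_ge0 ?(ltW (exp_gt0 _)) ?(ltW s0).
rewrite -exprS Rstruct.expRX; apply: exp_le; rewrite -[leLHS]mulr_natr.
apply: ler_wpM2l; first by lra.
by rewrite -natrX ler_nat ltn_expl.
Qed.

(** The sum is [(4^n - 1) / 3]: fewer than a third of the hubs are dropped. *)
Lemma sum_dropped (n : nat) : (2 * \sum_(r < n) 4 ^ (n - r.+1) <= 4 ^ n)%N.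
Proof.
suff : (3 * (\sum_(r < n) 4 ^ (n - r.+1)) < 4 ^ n)%N by lia.
elim: n => [|n IH]; first by rewrite big_ord0.
rewrite big_ord_recl /= subSS subn0 expnS; under eq_bigr do rewrite subSS.
by move: (4 ^ n)%N (\sum_(r < n) _)%N IH => x y; lia.
Qed.

(** The sum is the number of vertices in all connectors up to the factor [s ^ 2], a geometric series
    of ratio one half; adding [2 * 8 ^ n] avoids a subtraction. *)
Lemma sum_pieces (n : nat) : (\sum_(r < n) 8 ^ r * 16 ^ (n - r) + 2 * 8 ^ n = 2 * 16 ^ n)%N.
Proof.
elim: n => [|n IH]; first by rewrite big_ord0.
rewrite big_ord_recr /= subSnn expn1.
under eq_bigr => r _ do rewrite subSn ?(ltnW (ltn_ord r)) // expnS mulnCA.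
rewrite -big_distrr /= !expnS.
by move: (16 ^ n)%N (8 ^ n)%N (\sum_(r < n) _)%N IH => x y z; lia.
Qed.

(** * A large minor from a long path and fresh random edges *)

Section Sprinkling.
Variables (n Rn a s : nat) (eps : R).
Hypotheses (s2 : (2 <= s)%N) (a0 : (0 < a)%N).
Hypotheses (eps0 : 0 < eps) (aeps : 32 * eps <= a%:R) (epsn : eps <= n%:R).
Hypothesis n_lo : ((a * s) ^ 2 * 16 ^ Rn <= n)%N.
Hypothesis n_hi : (n <= 16 * ((a * s) ^ 2 * 16 ^ Rn))%N.
Hypothesis s_big : forall r : nat, 16 * exp 1 ^+ 2 * s%:R * 32 ^+ r <=
  exp ((omega a eps * s%:R / 2 - 1) * 2 ^+ r).

Lemma expect_no_minor_le (E1 : {set {set 'I_n}}) (y : nat) : has_path E1 y ->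
  ((a * s + 2 * s ^ 2) * 16 ^ Rn <= y)%N ->
  expect (pairs n) (eps / n%:R)
    (fun E2 => (~~ (4 ^ Rn <= 2 * ccl (E1 :|: E2))%N)%:R) <= 4 / 2 ^+ Rn.
Proof.
case/existsP=> t /andP [ut st] fit_y.
pose L := (a * s * 4 ^ Rn)%N.
pose sz r := (s * 4 ^ r)%N; pose m r := (s * (2 ^ r * 16 ^ (Rn - r)))%N.
have fit : (4 ^ Rn * L + \sum_(r < Rn) m r * sz r <= size t)%N.
  rewrite size_tuple; apply: leq_trans fit_y.
  have -> : (\sum_(r < Rn) m r * sz r = s ^ 2 * \sum_(r < Rn) 8 ^ r * 16 ^ (Rn - r))%N.
    rewrite big_distrr; apply: eq_bigr => r _ /=.
    rewrite /m /sz -[8%N]/(2 * 4)%N expnMn.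
    move: (2 ^ r)%N (4 ^ r)%N (16 ^ _)%N => x z w.
    by rewrite expnS expn1; ring.
  have -> : (4 ^ Rn * L = a * s * 16 ^ Rn)%N.
    by rewrite /L -[16%N]/(4 * 4)%N expnMn mulnCA.
  rewrite mulnDl leq_add2l (mulnC 2) -mulnA leq_mul2l; apply/orP; right.
  by rewrite -sum_pieces leq_addr.
pose D r := @hub_piece_edges n (4 ^ Rn) L sz m t r.
pose good r E2 := expanding (D r) E2 (16 ^ (Rn - r.+1)) (8 * 4 ^ (Rn - r)) (16 ^ (Rn - r)).
have n0 : 0 < n%:R :> R by apply: lt_le_trans epsn.
have p01 : 0 <= eps / n%:R <= 1.
  apply/andP; split; first by rewrite divr_ge0 // ltW.
  by rewrite ler_pdivrMr // mul1r.
apply: le_trans (_ : expect (pairs n) (eps / n%:R)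
   (fun E2 => \sum_(r < Rn) (~~ good r E2)%:R) <= _).
  apply: ler_expect => // E2 _.
  case: (boolP [forall r : 'I_Rn, good r E2]) => [/forallP Hg|]; last first.
    rewrite negb_forall => /existsP [r nr].
    rewrite (bigD1 r) //= nr.
    apply: le_trans (_ : 1 <= _); first by case: (~~ _).
    by rewrite lerDl; apply: sumr_ge0.
  suff -> : (4 ^ Rn <= 2 * ccl (E1 :|: E2))%N by apply: sumr_ge0.
  have [||||||||k' [kk' K]] := @sprinkled_minor n (4 ^ Rn) Rn L sz m t ut fit
     (fun r => 16 ^ (Rn - r))%N (fun r => 8 * 4 ^ (Rn - r))%N
     (fun r => 4 ^ (Rn - r.+1))%N E1 E2 st.
  - by rewrite !muln_gt0 a0 expn_gt0 !andbT /=; apply: leq_trans s2.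
  - by move=> r; rewrite muln_gt0 expn_gt0 andbT; apply: leq_trans s2.
  - by rewrite subn0 -expnMn.
  - by rewrite expn_gt0.
  - by rewrite subnn.
  - move=> r rR; split; last by rewrite muln_gt0 expn_gt0.
    rewrite -(subnSK rR) !expnS -[16%N]/(4 * 4)%N expnMn.
    by move: (4 ^ _)%N => x; rewrite leq_eqVlt; apply/orP; left; apply/eqP; ring.
  - by move=> r rR; apply: (Hg (Ordinal rR)).
  - exact: sum_dropped.
  - by apply: leq_trans kk' _; rewrite leq_mul2l ccl_ge.
rewrite expect_sum.
apply: le_trans (_ : \sum_(r < Rn) exp (- 2 ^+ Rn) <= _).
  apply: ler_sum => r _; have rR := ltn_ord r.
  apply: le_trans (@expect_round_fails _ (pairs n) n Rn r a s eps (D r)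
    _ _ _ rR s2 a0 eps0 aeps epsn n_lo n_hi (s_big r)) _.
  - by move=> q i; exact: (@hub_piece_edges_sub n (4 ^ Rn) L sz m t ut r q i).
  - by move=> q i q' i' ne; exact: (@hub_piece_edges_disjoint n (4 ^ Rn) Rn L sz m t ut r q i q' i' rR ne).
  - by move=> q i; exact: (@card_hub_piece_edges n (4 ^ Rn) Rn L sz m t ut fit r q i rR).
  (* Since [2^r * 16^(Rn-r) >= 2^Rn], one bound serves all rounds. *)
  apply: exp_le; rewrite lerN2 -natrX ler_nat.
  rewrite -{1}(subnKC (ltnW rR)) expnD leq_mul2l; apply/orP; right.
  by rewrite leq_exp2r // subn_gt0.
rewrite sumr_const card_ord -[leLHS]mulr_natl.
have h2 : 0 < 2 ^+ Rn :> R by rewrite exprn_gt0.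
have hR : Rn%:R <= 2 ^+ Rn :> R by rewrite -natrX ler_nat ltnW // ltn_expl.
(* The bound [exp x >= x^2 / 4] at [x = 2^Rn] has room for the [Rn <= 2^Rn] rounds. *)
have he : exp (- 2 ^+ Rn) * (2 ^+ Rn) ^+ 2 <= 4.
  have := exp_ge_sqr (ltW h2); have := exp_gt0 (- 2 ^+ Rn).
  have : exp (2 ^+ Rn) * exp (- 2 ^+ Rn) = 1.
    by rewrite Rstruct.expRD Rstruct.RplusE subrr Rstruct.expR0.
  move: (exp (2 ^+ Rn)) (exp (- 2 ^+ Rn)) (2 ^+ Rn) => u v x uv v0 xu; nra.
rewrite ler_pdivlMr //; have e0 := exp_gt0 (- 2 ^+ Rn).
apply: le_trans he; rewrite [leRHS]mulrC expr2 mulrAC.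
apply: ler_wpM2r; first exact: ltW.
by apply: ler_wpM2r => //; exact: ltW.
Qed.

End Sprinkling.

(** * Assembly *)

Lemma trunc_scale (d n : nat) : (0 < d)%N -> (d <= n)%N ->
  exists q : nat, (d * 16 ^ q <= n)%N /\ (n < 16 * (d * 16 ^ q))%N.
Proof.
move=> d0 dn; exists (trunc_log 16 (n %/ d)).
have nd : (0 < n %/ d)%N by rewrite divn_gt0.
have /andP [lo hi] := trunc_log_bounds (isT : (1 < 16)%N) nd.
split; first by rewrite mulnC -leq_divRL.
by rewrite mulnCA -expnS mulnC -ltn_divLR.
Qed.

(** Order of choices: [gam] from the path, then [a], then [s], which depends on [a] through [omega].
    The number [Rn] of rounds is then read off from [n], so [delta] does not depend on [eta]. *)
Lemma expect_small_ccl (c : R) : 1 < c ->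
  exists delta : R, 0 < delta /\ forall eta : R, 0 < eta ->
    exists N : nat, forall n : nat, (N <= n)%N ->
      expect (pairs n) (c / n%:R)
        (fun E => (~~ (delta * Num.sqrt n%:R <= (ccl E)%:R))%:R) <= eta.
Proof.
move=> c1; pose eps := (c - 1) / 2.
have eps0 : 0 < eps by rewrite /eps; lra.
have [|gam [n0 [gam0 Hpath]]] := @expect_no_long_path ((c + 1) / 2); first by lra.
have [a1 Ha1] := nat_above (2 / gam); have [a2 Ha2] := nat_above (32 * eps).
(* [2 / gam <= a] makes the blocks fit on a path of [gam * n] vertices; [32 * eps <= a] keeps links
   rare enough for the second moment. *)
pose a := (a1 + a2 + 2)%N.
have a_gt0 : (0 < a)%N by rewrite /a addn2.
have aeps : 32 * eps <= a%:R by apply: le_trans Ha2 _; rewrite ler_nat /a; lia.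
have agam : 2 / gam <= a%:R by apply: le_trans Ha1 _; rewrite ler_nat /a; lia.
have a2' : (2 <= a)%N by rewrite leq_addl.
clearbody a => {a1 a2 Ha1 Ha2}.
have a0 : 0 < a%:R :> R by rewrite ltr0n.
have om0 : 0 < omega a eps by rewrite /omega divr_gt0 // exprn_gt0 // divr_gt0 // mulr_gt0.
have [s [s2 s_big]] := exists_scale om0.
have s0 : 0 < s%:R :> R by rewrite ltr0n; apply: leq_trans s2.
pose d := ((a * s) ^ 2)%N.
have d0 : (0 < d)%N by rewrite /d expn_gt0 muln_gt0 a_gt0 (leq_trans _ s2).
(* From [sqrt n <= 4 * a * s * 4 ^ Rn] and [4 ^ Rn <= 2 * ccl E]. *)
exists (8 * a%:R * s%:R)^-1; split; first by rewrite invr_gt0 !mulr_gt0.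
move=> eta eta0.
(* [R0] makes the sprinkling error [4 / 2^Rn] at most [eta / 2], [n1] does the same for the missing
   path, and [n2] gives [p <= 1 / 2]. *)
have [R0 HR0] := expr_unbounded (8 / eta) (ltr1n R 2 : 1 < 2%:R).
have [n1 Hn1] := nat_above (2 / (gam * eta)); have [n2 Hn2] := nat_above (2 * c).
exists (n0 + n1 + n2 + d * 16 ^ R0)%N => n nN.
have [nn0 nn1' nn2' ndR] : [/\ n0 <= n, n1 <= n, n2 <= n & d * 16 ^ R0 <= n]%N.
  by move: (d * 16 ^ R0)%N nN => x nN; clear -nN; split; lia.
have nn1 : 2 / (gam * eta) <= n%:R by apply: le_trans Hn1 _; rewrite ler_nat.
have nn2 : 2 * c <= n%:R by apply: le_trans Hn2 _; rewrite ler_nat.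
have [Rn [n_lo n_hi]] : exists q, (d * 16 ^ q <= n)%N /\ (n < 16 * (d * 16 ^ q))%N.
  by apply: trunc_scale => //; apply: leq_trans ndR; rewrite leq_pmulr // expn_gt0.
have RR : (R0 <= Rn)%N.
  rewrite -ltnS -(ltn_exp2l _ _ (isT : (1 < 16)%N)) expnS -(ltn_pmul2l d0).
  by apply: leq_ltn_trans ndR _; rewrite mulnCA.
have n_pos : 0 < n%:R :> R by lra.
have epsn : eps <= n%:R by rewrite /eps; lra.
(* [p1] solves [1 - p = (1 - p1) * (1 - p2)]; then [p1 >= p - p2] keeps [p1 * n] at least
   [c - eps = (c + 1) / 2 > 1]. *)
pose p := c / n%:R; pose p2 := eps / n%:R; pose p1 := (p - p2) / (1 - p2).
have p_half : p <= 2^-1 by rewrite /p ler_pdivrMr //; lra.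
have p0 : 0 < p by rewrite divr_gt0 //; lra.
have p2_lt : p2 < p by rewrite ltr_pM2r ?invr_gt0 // /eps; lra.
have p2_gt0 : 0 < p2 by rewrite divr_gt0.
have q2 : 0 < 1 - p2 by lra.
have p1_lo : p - p2 <= p1 by rewrite /p1 ler_pdivlMr // ler_piMr //; lra.
have p1_hi : p1 <= 2^-1.
  by rewrite /p1 ler_pdivrMr //; lra.
have p1_01 : 0 <= p1 <= 1 by apply/andP; split; lra.
have p_eq : 1 - p = (1 - p1) * (1 - p2) by rewrite /p1; field; rewrite gt_eqF.
have p1n : (c + 1) / 2 <= p1 * n%:R.
  apply: le_trans (ler_wpM2r (ltW n_pos) p1_lo).
  by rewrite mulrBl !divfK ?gt_eqF // /eps; lra.
have [|y [y_ge Hy]] := Hpath n p1 nn0 _ p1n; first by apply/andP; split; lra.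
have dE : d%:R = a%:R ^+ 2 * s%:R ^+ 2 :> R by rewrite /d natrX natrM exprMn.
have fit_y : ((a * s + 2 * s ^ 2) * 16 ^ Rn <= y)%N.
  rewrite -(ler_nat R); apply: le_trans y_ge.
  apply: le_trans (_ : gam * (d * 16 ^ Rn)%:R <= _); last first.
    by apply: ler_wpM2l; [exact: ltW | rewrite ler_nat].
  rewrite (natrM _ d) (natrM _ (a * s + _)) mulrA; apply: ler_wpM2r => //.
  have sE : (a * s + 2 * s ^ 2)%:R = a%:R * s%:R + 2 * s%:R ^+ 2 :> R.
    by rewrite natrD (natrM _ a) (natrM _ 2) natrX.
  rewrite dE sE.
  have s1 : (1 : R) <= s%:R by rewrite ler1n (leq_trans _ s2).
  have ag : 2 <= gam * a%:R by rewrite mulrC -ler_pdivrMr.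
  have a2r : (2 : R) <= a%:R by rewrite ler_nat.
  apply: le_trans (_ : (2 * a%:R) * s%:R ^+ 2 <= _).
    have h : s%:R <= s%:R ^+ 2 :> R by rewrite expr2 ler_peMr // ltW.
    have := ler_wpM2l (ltW a0) h; have := ler_wpM2r (sqr_ge0 (s%:R : R)) a2r; lra.
  have -> : gam * (a%:R ^+ 2 * s%:R ^+ 2) = (gam * a%:R) * a%:R * s%:R ^+ 2 by ring.
  apply: ler_wpM2r; first exact: sqr_ge0.
  by apply: ler_wpM2r => //; exact: ltW.
have low E : (4 ^ Rn <= 2 * ccl E)%N -> (8 * a%:R * s%:R)^-1 * Num.sqrt n%:R <= (ccl E)%:R :> R.
  move=> H; rewrite mulrC ler_pdivrMr ?mulr_gt0 //.
  have sq : Num.sqrt n%:R <= 4 * (a%:R * s%:R * 4 ^+ Rn) :> R.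
    have as0 : 0 <= 4 * (a%:R * s%:R * 4 ^+ Rn) :> R.
      by rewrite !mulr_ge0 // exprn_ge0.
    rewrite -(ler_pXn2r (n := 2)) ?nnegrE ?sqrtr_ge0 // sqr_sqrtr ?ler0n //.
    apply: le_trans (_ : (16 * (d * 16 ^ Rn))%:R <= _); first by rewrite ler_nat ltnW.
    have f16 : (16 ^ Rn)%:R = (4 ^+ Rn) ^+ 2 :> R.
      by rewrite -natrX -natrX -expnM mulnC expnM.
    rewrite (natrM _ 16) (natrM _ d) dE f16 le_eqVlt; apply/orP; left; apply/eqP.
    by ring.
  have H' : 4 ^+ Rn <= 2 * (ccl E)%:R :> R by rewrite -natrX -natrM ler_nat.
  apply: le_trans sq _.
  have -> : (ccl E)%:R * (8 * a%:R * s%:R) = 4 * (a%:R * s%:R * (2 * (ccl E)%:R)) :> R by ring.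
  by rewrite !ler_pM2l ?mulr_gt0.
rewrite -/p (expect_coupling _ _ p_eq).
apply: le_trans (_ : expect (pairs n) p1
   (fun E1 => (~~ has_path E1 y)%:R + 4 / 2 ^+ Rn) <= _).
  apply: ler_expect => // E1 _.
  have p2_01 : 0 <= p2 <= 1 by apply/andP; split; lra.
  case: (boolP (has_path E1 y)) => hp /=; last first.
    apply: le_trans (_ : expect (pairs n) p2 (fun=> 1) <= _).
      by apply: ler_expect => // E2 _; case: (~~ _).
    by rewrite expect_cst lerDl divr_ge0 // exprn_ge0.
  rewrite add0r.
  have := @expect_no_minor_le n Rn a s eps s2 a_gt0 eps0 aeps epsn n_lo (ltnW n_hi) s_big E1 y hp fit_y.
  apply: le_trans; apply: ler_expect => // E2 _.
  case: (boolP (4 ^ Rn <= _)%N) => [/low -> //|_].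
  by case: (~~ _).
rewrite expectD expect_cst.
have gn0 : 0 < gam * n%:R by rewrite mulr_gt0.
have h1 : expect (pairs n) p1 (fun E => (~~ has_path E y)%:R) <= eta / 2.
  rewrite -ler_pdivlMr // in Hy; apply: le_trans Hy _.
  rewrite div1r -[eta / 2]invrK lef_pV2 ?posrE ?invr_gt0 ?divr_gt0 //.
  rewrite invf_div -ler_pdivrMl //.
  apply: le_trans nn1; rewrite le_eqVlt; apply/orP; left; apply/eqP; field.
  by rewrite !gt_eqF.
have h2 : 4 / 2 ^+ Rn <= eta / 2.
  have e2 : 2 ^+ R0 <= 2 ^+ Rn :> R by rewrite ler_weXn2l // ler1n.
  have e3 : 8 / eta <= 2 ^+ Rn by apply: le_trans e2.
  rewrite ler_pdivrMr // in e3; rewrite ler_pdivrMr ?exprn_gt0 //.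
  by move: e3; move: (2 ^+ Rn) => z; lra.
by move: h1 h2; move: (expect _ _ _) (4 / _) => u w; lra.
Qed.

Lemma Pr_Gnp_expect (n : nat) (p : R) (A : {set {set 'I_n}} -> Prop)
    (F : {set {set 'I_n}} -> bool) :
  (forall E, A E <-> F E) -> Pr_Gnp p A = expect (pairs n) p (fun E => (F E)%:R).
Proof.
move=> AF; rewrite /Pr_Gnp /expect; apply: eq_bigr => E _.
rewrite /Gnp_weight /wt /is_graph; case: ClassicalEpsilon.excluded_middle_informative => H.
  have -> : F E = true by apply/AF.
  by rewrite mulr1 !RpowE.
have -> : F E = false by apply/negP => /AF.
by rewrite mulr0.
Qed.

(** [A] is left abstract so that the event written with the Stdlib operations on reals can be
    substituted through an equivalence. *)
Lemma Pr_Gnp_ccl (c delta eta : R) : 1 < c -> 0 < eta ->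
  (forall eta' : R, 0 < eta' -> exists N : nat, forall n : nat, (N <= n)%N ->
     expect (pairs n) (c / n%:R)
       (fun E => (~~ (delta * Num.sqrt n%:R <= (ccl E)%:R))%:R) <= eta') ->
  exists N : nat, forall n : nat, (N <= n)%N -> forall A : {set {set 'I_n}} -> Prop,
    (forall E, A E <-> (delta * Num.sqrt n%:R <= (ccl E)%:R <= 2 * Num.sqrt (c * n%:R))) ->
    `|Pr_Gnp (c / n%:R) A - 1| < eta.
Proof.
move=> c1 eta0 low_tail.
have [|N1 HN1] := low_tail (eta / 4); first by rewrite divr_gt0.
have [n2 Hn2] := nat_above c; have [n3 Hn3] := nat_above (32 / eta).
exists (N1 + n2 + n3)%N => n nN A AE.
have nn1 : (N1 <= n)%N by lia.
have nn2 : c <= n%:R by apply: le_trans Hn2 _; rewrite ler_nat; lia.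
have nn3 : 32 / eta <= n%:R by apply: le_trans Hn3 _; rewrite ler_nat; lia.
have n0 : 0 < n%:R :> R by lra.
have low := HN1 n nn1; have high := expect_many_edges c1 nn2.
pose F (E : {set {set 'I_n}}) :=
  delta * Num.sqrt n%:R <= (ccl E)%:R <= 2 * Num.sqrt (c * n%:R).
rewrite (@Pr_Gnp_expect _ _ _ F AE).
have p01 : 0 <= c / n%:R <= 1.
  apply/andP; split; first by rewrite divr_ge0 // ltW //; lra.
  by rewrite ler_pdivrMr // mul1r.
set P := expect _ _ _.
have P1 : P <= 1.
  rewrite -[leRHS](expect_cst (pairs n) (c / n%:R)); apply: ler_expect => // E _.
  by case: (F E).
(* If the event fails, either the lower bound fails or there are more than [c * n] edges. *)
have P0 : 1 - P <= expect (pairs n) (c / n%:R)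
     (fun E => (~~ (delta * Num.sqrt n%:R <= (ccl E)%:R))%:R) +
   expect (pairs n) (c / n%:R) (fun E => (c * n%:R < #|E|%:R)%R%:R).
  rewrite -expectD -[X in X - P](expect_cst (pairs n) (c / n%:R)) -expectB.
  apply: ler_expect => // E _; rewrite /F.
  case: (delta * _ <= _); last by case: (_ < _); rewrite /=; lra.
  case: (ltP (c * n%:R) #|E|%:R) => [_|H]; first by case: (_ <= 2 * Num.sqrt _); rewrite /=; lra.
  rewrite ccl_le_edges ?subrr ?addr0 //.
  by rewrite -(ltr0n R).
have h4 : 8 / (c * n%:R) <= eta / 4.
  rewrite ler_pdivrMr in nn3; last exact: eta0.
  rewrite ler_pdivrMr ?mulr_gt0 //; last by lra.
  have -> : eta / 4 * (c * n%:R) = c * (n%:R * eta) / 4 by ring.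
  have : 0 < n%:R * eta by rewrite mulr_gt0.
  by move: nn3; move: (n%:R * eta) => z; nra.
rewrite ltr_norml; apply/andP; split; last by lra.
by move: P0 low high h4; move: (expect _ _ _) (expect _ _ _) (8 / _) => u w x; lra.
Qed.

(* Imported only here, since it rebinds the delimiting key R to R_scope. *)
From Stdlib Require Import Reals.
Local Close Scope ring_scope.

Theorem theorem3 :
  forall c : R, (1 < c)%R ->
  exists delta : R, (0 < delta)%R /\
    aas (fun n => (c / INR n)%R)
        (fun n E => (delta * sqrt (INR n) <= INR (ccl E) <= 2 * sqrt (c * INR n))%R).
Proof.
move=> c /RltP c1.
have [delta [delta0 low]] := expect_small_ccl c1.
exists delta; split; first exact/RltP.
move=> eta /RltP eta0; have [N HN] := Pr_Gnp_ccl c1 eta0 low.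
exists N => n /ssrnat.leP Nn; apply/RltP; rewrite RdistE INRE RdivE.
apply: HN => // E; rewrite !INRE !RsqrtE.
by split=> [[/RleP lo /RleP hi]|/andP [/RleP lo /RleP hi]]; first apply/andP.
Qed.
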